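(* Let $A$ be a unital C*-algebra of real rank zero that admits no characters. Then $\xi(A)\leq3$ and $A=[A,A]_1+[A,A]_1\cdot[A,A]_1$, i.e. every element of $A$ is of the form $[b,c]+[d,e][f,g]$ with $b,c,d,e,f,g\in A$.
   Context: $[x,y]=xy-yx$; $[A,A]_1$ is the set of commutators; $X\cdot Y$ is the set of products and $X+Y$ the set of sums. A unital C*-algebra has real rank zero if self-adjoint elements with finite spectrum are dense among self-adjoint elements. A character is a nonzero homomorphism $A\to\mathbb{C}$. For a unital ring $T$ generated by its commutators, $\xi(T)$ is the minimal $N$ such that every element of $T$ is a sum of $N$ elements of the form $[b,c][d,e]$ with $b,c,d,e\in T$. *)

(* Defs.v *)
From HB Require Import structures.
From mathcomp Require Import all_boot all_order all_algebra.
From mathcomp Require Import complex.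
From mathcomp Require Import reals.
Set Implicit Arguments. Unset Strict Implicit. Unset Printing Implicit Defensive.
Import Order.TTheory GRing.Theory Num.Theory.
Local Open Scope ring_scope.

Section CStar.
Variable R : realType.
Local Notation C := R[i].
Variable A : algType C.

Record is_unital_cstar (star : A -> A) (nrm : A -> R) : Prop := {
  star_add : forall x y, star (x + y) = star x + star y;
  star_scale : forall (l : C) x, star (l *: x) = (conjc l) *: star x;
  star_mul : forall x y, star (x * y) = star y * star x;
  star_invol : forall x, star (star x) = x;
  nrm_ge0 : forall x, 0 <= nrm x;
  nrm_eq0 : forall x, nrm x = 0 -> x = 0;
  nrm_triangle : forall x y, nrm (x + y) <= nrm x + nrm y;
  nrm_scale : forall (l : C) x, nrm (l *: x) = ComplexField.Normc.normc l * nrm x;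
  nrm_submul : forall x y, nrm (x * y) <= nrm x * nrm y;
  nrm_one : nrm 1 = 1;
  cstar_identity : forall x, nrm (star x * x) = nrm x ^+ 2;
  nrm_complete : forall u : nat -> A,
    (forall e : R, 0 < e -> exists N, forall m n, (N <= m)%N -> (N <= n)%N ->
        nrm (u m - u n) < e) ->
    exists l, forall e : R, 0 < e -> exists N, forall n, (N <= n)%N ->
        nrm (u n - l) < e
}.

Definition invertible (x : A) : Prop := exists y, x * y = 1 /\ y * x = 1.

Definition in_spectrum (x : A) (l : C) : Prop := ~ invertible (x - l%:A).

Definition finite_spectrum (x : A) : Prop :=
  exists s : seq C, forall l, in_spectrum x l -> l \in s.

Definition self_adjoint (star : A -> A) (x : A) : Prop := star x = x.

Definition real_rank_zero (star : A -> A) (nrm : A -> R) : Prop :=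
  forall a, self_adjoint star a -> forall e : R, 0 < e ->
    exists b, [/\ self_adjoint star b, finite_spectrum b & nrm (a - b) < e].

Definition is_character (f : A -> C) : Prop :=
  [/\ (forall x y, f (x + y) = f x + f y),
      (forall (l : C) x, f (l *: x) = l * f x),
      (forall x y, f (x * y) = f x * f y)
    & exists x, f x != 0].

End CStar.

Definition commr {T : nzRingType} (x y : T) : T := x * y - y * x.

(* Main.v *)
From Stdlib Require Import Ncring Ncring_tac.
Require Import Defs.
From HB Require Import structures.
From mathcomp Require Import all_boot all_order all_algebra.
From mathcomp Require Import complex boolp classical_sets.
From mathcomp Require Import reals ring lra.
Set Implicit Arguments. Unset Strict Implicit. Unset Printing Implicit Defensive.
Import Order.TTheory GRing.Theory Num.Theory.
Local Open Scope ring_scope.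

(** Real rank zero makes [A] an exchange ring: if [a + b = 1], let [p] be the
    spectral projection on [[0, oo[] of a finite-spectrum approximant [k'] of
    [k = a a* - b b*]. Then [w = a a* p + b b* (1 - p)] is close to
    [1/4 + z z* / 4 + |k'| / 2] with [z = a - b], hence invertible, and
    [w p w^-1] is an idempotent of [a A] whose complement lies in [b A].

    If the idempotents [x] with [x <~ 1 - x] generated a proper ideal, a maximal
    ideal [M] above it would contain [p] or [1 - p] for each projection [p], so
    each element of finite spectrum, and then every element, would be scalar
    modulo [M], which gives a character. So [1] is in that ideal, and exchange
    yields an idempotent [P] with [P] and [Q = 1 - P] both full; then [P] (resp.
    [Q]) is an orthogonal sum of idempotents [p_i] with [p_i <~ Q] (resp. [<~ P]).

    An element off-diagonal with respect to the [p_i] is a commutator. With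
    [p_i = u_i w_i], [U = sum u_i] and [W = sum w_i], the elements [U] and
    [W diag(x)] are off-diagonal and [x - U W diag(x)] is an off-diagonal element
    [c]. Finally there are commutators [Y], [Z] with [Y P = P] and [Z Q = Q], so
    that [c = Y (P c) + Z (Q c)] is a sum of two products of commutators. *)

(** * Normalisation of identities in noncommutative rings *)

Ltac ncring := non_commutative_ring.

#[local] Instance nc_ops (A : nzRingType) :
  @Ring_ops A 0 1 +%R *%R (fun x y => x - y) -%R (@eq A) := {}.
#[local] Instance nc_ring (A : nzRingType) :
  @Ring A 0 1 +%R *%R (fun x y => x - y) -%R (@eq A) (nc_ops A).
Proof.
split; try (by move=> ? ? -> ? ? ->).
- exact: RelationClasses.eq_equivalence.
- by move=> ? ? ->.
- exact: add0r.
- exact: addrC.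
- exact: addrA.
- exact: mul1r.
- exact: mulr1.
- exact: mulrA.
- exact: mulrDl.
- by move=> x y z; exact: mulrDr.
- by [].
- exact: subrr.
Qed.
#[local] Instance nc_alg_ops (K : nzRingType) (A : algType K) :
  @Ring_ops A 0 1 +%R *%R (fun x y => x - y) -%R (@eq A) := nc_ops A.
#[local] Instance nc_alg_ring (K : nzRingType) (A : algType K) :
  @Ring A 0 1 +%R *%R (fun x y => x - y) -%R (@eq A) (nc_alg_ops A) := nc_ring A.

(** * Exchange rings *)

Section RingTheory.
Variable A : nzRingType.
Implicit Types (a b c e f h k p q r s t x y z : A) (S : A -> Prop).

Definition idem e := e * e = e.

(* For idempotents this is Murray-von Neumann subequivalence [x <~ z]. *)
Definition subequiv z x := exists a c, x = a * z * c.

Definition mul_closed S := forall a x c, S x -> S (a * x * c).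

Lemma subequiv_closed z : mul_closed (subequiv z).
Proof. by move=> a _ c [a' [c' ->]]; exists (a * a'), (c' * c); rewrite !mulrA. Qed.

(** The two-sided ideal generated by [S]. Negatives come from the coefficient -1, and the inductive
    form allows [halving_above] to absorb one generator at a time. *)
Inductive ideal S : A -> Prop :=
| ideal0 : ideal S 0
| idealD x y : ideal S x -> ideal S y -> ideal S (x + y)
| idealG a z c : S z -> ideal S (a * z * c).

Lemma ideal_closed S : mul_closed (ideal S).
Proof.
move=> a x c; elim=> [|y z _ IHy _ IHz|b z d Sz].
- by rewrite mulr0 mul0r; constructor.
- by rewrite mulrDr mulrDl; constructor.
- have -> : a * (b * z * d) * c = (a * b) * z * (d * c) by rewrite !mulrA.
  exact: idealG.
Qed.

Lemma ideal_mull S a x : ideal S x -> ideal S (a * x).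
Proof. by move=> Sx; rewrite -[_ * _]mulr1; exact: ideal_closed. Qed.

Lemma ideal_mulr S a x : ideal S x -> ideal S (x * a).
Proof. by move=> Sx; rewrite -[x]mul1r; exact: ideal_closed. Qed.

Lemma idealN S x : ideal S x -> ideal S (- x).
Proof. by move=> Sx; rewrite -mulN1r; exact: ideal_mull. Qed.

Lemma idealB S x y : ideal S x -> ideal S y -> ideal S (x - y).
Proof. by move=> Sx Sy; apply: idealD => //; exact: idealN. Qed.

Lemma ideal_mem S x : S x -> ideal S x.
Proof. by move=> Sx; rewrite -[x]mulr1 -[x]mul1r; exact: idealG. Qed.

Lemma ideal_min S S' x :
  (forall z, S z -> ideal S' z) -> ideal S x -> ideal S' x.
Proof.
move=> SS'; elim=> [|y z _ ? _ ?|a z c /SS' ?]; first exact: ideal0.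
  exact: idealD.
exact: ideal_closed.
Qed.

Local Notation ideal1 z := (ideal (eq z)).

Lemma ideal1_min z S x : ideal S z -> ideal1 z x -> ideal S x.
Proof. by move=> Sz; apply: ideal_min => _ <-. Qed.

Lemma ideal1_refl z : ideal1 z z.
Proof. exact: ideal_mem. Qed.

Lemma ideal1_sum z x : ideal1 z x ->
  exists s : seq A, (forall y, y \in s -> subequiv z y) /\ x = \sum_(y <- s) y.
Proof.
elim=> [|_ _ _ [s [Ss ->]] _ [t [St ->]]|a _ c <-].
- by exists [::]; rewrite big_nil.
- exists (s ++ t); rewrite big_cat; split=> // y.
  by rewrite mem_cat => /orP[/Ss|/St].
- exists [:: a * z * c]; rewrite big_seq1; split=> // y.
  by rewrite inE => /eqP ->; exists a, c.
Qed.

(** The Goodearl-Nicholson form of the exchange property: some idempotent of [aA] has its complement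
    in [(1 - a)A]. *)
Definition exchange :=
  forall a, exists e s t, [/\ idem e, e = a * s & 1 - e = (1 - a) * t].

(** If [e] is an exchange idempotent for [x], then [r e = e] because [e] lies in [xA]; hence [e r]
    is an idempotent under [r], with [r - e r = r (1 - e) r]. *)
Lemma corner_exchange r x : exchange -> idem r -> r * x = x ->
  exists e s t, [/\ idem e, r * e = e, e * r = e, e = x * s & r - e = (r - x) * t].
Proof.
move=> ex rr rx; have [e [s [t [ee es et]]]] := ex x.
have re : r * e = e by rewrite es mulrA rx.
exists (e * r), (s * r), (t * r); split.
- by rewrite /idem -mulrA (mulrA r) re mulrA ee.
- by rewrite mulrA re.
- by rewrite -mulrA rr.
- by rewrite es mulrA.
- have -> : r - e * r = r * (1 - e) * r by rewrite mulrBr mulr1 re mulrBl rr.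
  by rewrite et !mulrA mulrBr mulr1 rx.
Qed.

(** * Families of orthogonal idempotents *)

(** Indexing by position allows repeated zero entries. Indices beyond the end are harmless, since
    the default value 0 satisfies both cases. *)
Definition orth_idems (b : seq A) :=
  forall i j, b`_i * b`_j = if i == j then b`_i else 0.

Lemma orth_idems_suml (b : seq A) i : orth_idems b -> (\sum_(x <- b) x) * b`_i = b`_i.
Proof.
move=> ob; rewrite (big_nth 0) mulr_suml big_mkord.
have [ilt|ige] := ltnP i (size b).
  rewrite (bigD1 (Ordinal ilt)) //= ob eqxx big1 ?addr0 // => j ji.
  by rewrite ob -val_eqE /= in ji *; rewrite (negbTE ji).
by rewrite nth_default // big1 // => j _; rewrite mulr0.
Qed.

Lemma orth_idems_sumr (b : seq A) i : orth_idems b -> b`_i * (\sum_(x <- b) x) = b`_i.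
Proof.
move=> ob; rewrite (big_nth 0) mulr_sumr big_mkord.
have [ilt|ige] := ltnP i (size b).
  rewrite (bigD1 (Ordinal ilt)) //= ob eqxx big1 ?addr0 // => j ji.
  by rewrite ob -val_eqE /= eq_sym in ji *; rewrite (negbTE ji).
by rewrite [b`_i]nth_default // big1 // => j _; rewrite mul0r.
Qed.

Lemma orth_idems_idem (b : seq A) : orth_idems b -> idem (\sum_(x <- b) x).
Proof.
move=> ob; rewrite /idem {2 3}(big_nth 0) mulr_sumr.
by apply: eq_bigr => i _; rewrite orth_idems_suml.
Qed.

Lemma orth_idems_cat (b c : seq A) : orth_idems b -> orth_idems c ->
  (\sum_(x <- b) x) * (\sum_(x <- c) x) = 0 ->
  (\sum_(x <- c) x) * (\sum_(x <- b) x) = 0 -> orth_idems (b ++ c).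
Proof.
move=> ob oc bc cb i j; rewrite !nth_cat.
case: ltnP => ib; case: ltnP => jb.
- exact: ob.
- rewrite -[b`_i]orth_idems_sumr // -[c`_ _]orth_idems_suml // mulrA -(mulrA b`_i).
  by rewrite bc mulr0 mul0r; case: eqP => // ij; move: jb; rewrite -ij leqNgt ib.
- rewrite -[c`_(i - _)]orth_idems_sumr // -[b`_ _]orth_idems_suml // mulrA -(mulrA c`_(i - _)).
  by rewrite cb mulr0 mul0r; case: eqP => // ij; move: ib; rewrite ij leqNgt jb.
- by rewrite oc -(eqn_add2r (size b)) !subnK.
Qed.

(** Induction on the number of summands. Exchange for [r x r] under [r] splits off an idempotent [e]
    that is a multiple of [x]. The complement [f] is a right multiple of [r y r], so it is again a
    sum of multiples of the remaining summands. *)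
Lemma multi_exchange S r (s : seq A) : exchange -> mul_closed S -> idem r ->
  (forall x, x \in s -> S x) -> r = \sum_(x <- s) x ->
  exists b : seq A, [/\ orth_idems b, r = \sum_(x <- b) x & forall x, x \in b -> S x].
Proof.
move=> ex Sc; have [n] := ubnP (size s); elim: n s r => // n IHn [|x s] r /= ns rr Ss.
  rewrite big_nil => r0; exists [::]; split=> //; last by rewrite big_nil.
  by move=> i j; rewrite !nth_nil mulr0; case: ifP.
rewrite big_cons => rE; set y := \sum_(x <- s) x in rE.
have rrE : r - r * x * r = r * y * r.
  by apply/eqP; rewrite subr_eq -mulrDl -mulrDr addrC -rE rr rr.
have [|e [u [t [ee re er eE fE]]]] := @corner_exchange r (r * x * r) ex rr.
  by rewrite !mulrA rr.
set f := r - e in fE; have ff : idem f.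
  by rewrite /idem /f mulrBl !mulrBr rr re er ee subrr subr0.
have ef0 : e * f = 0 by rewrite /f mulrBr er ee subrr.
have fe0 : f * e = 0 by rewrite /f mulrBl re ee subrr.
have [||||b [ob fb Sb]] := IHn [seq f * r * z * (r * t * f) | z <- s] f.
- by rewrite size_map.
- exact: ff.
- by move=> _ /mapP[z zs ->]; apply: (Sc); apply: Ss; rewrite inE zs orbT.
- rewrite big_map -mulr_suml -mulr_sumr -/y.
  transitivity (f * (r * y * r * t) * f); last by rewrite !mulrA.
  by rewrite -rrE -fE ff ff.
have fbi i : f * b`_i = b`_i by rewrite fb orth_idems_suml.
have bif i : b`_i * f = b`_i by rewrite fb orth_idems_sumr.
exists (e :: b); split.
- move=> [|i] [|j] //=; rewrite ?eqSS.
  + by rewrite -fbi mulrA ef0 mul0r.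
  + by rewrite -bif -mulrA fe0 mulr0.
  + by rewrite ob.
- by rewrite big_cons -fb /f addrC subrK.
- move=> z; rewrite inE => /orP[/eqP ->|/Sb //].
  rewrite eE -[_ * u]mul1r mulrA; apply: (Sc); apply: (Sc).
  by apply: Ss; rewrite inE eqxx.
Qed.

(** * Two orthogonal idempotents that generate the same ideal *)

Definition halvable x := idem x /\ subequiv (1 - x) x.

Definition halving P Q :=
  [/\ idem P, idem Q, P * Q = 0, Q * P = 0 & ideal1 P Q /\ ideal1 Q P].

(** Exchange splits the remainder [r = 1 - P - Q] into [h], a multiple of [x], and [k], a multiple
    of [1 - x]. Modulo the ideal of [P + Q], [h] factors through [k]; so up to that ideal [h] is an
    idempotent [h1] with a copy [h'] under [k]. Adding [h1] to [P] and [h'] to [Q] keeps the pair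
    orthogonal, and its ideal now contains [x]. *)
Lemma merge P Q x : exchange -> halving P Q -> idem x -> subequiv (1 - x) x ->
  exists P' Q', [/\ halving P' Q', ideal1 P' P & ideal1 P' x].
Proof.
move=> ex [PP QQ PQ QP [IQ IP]] xx [a [c xE]].
set r := 1 - P - Q; have rr : idem r.
  rewrite /idem /r; transitivity (1 - P - Q - (P - P * P) - (Q - Q * Q) + P * Q + Q * P); first by ncring.
  by rewrite PP QQ PQ QP !subrr !subr0 !addr0.
have Pr : P * r = 0 by rewrite /r !mulrBr mulr1 PP PQ subrr subr0.
have rP : r * P = 0 by rewrite /r !mulrBl mul1r PP QP subrr subr0.
have Qr : Q * r = 0 by rewrite /r !mulrBr mulr1 QQ QP subr0 subrr.
have rQ : r * Q = 0 by rewrite /r !mulrBl mul1r QQ PQ subr0 subrr.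
have one : 1 = r + (P + Q) by rewrite /r; ncring.
have [|h [s [t [hh rh hr hE kE]]]] := @corner_exchange r (r * x * r) ex rr.
  by rewrite !mulrA rr.
set k := r - h in kE.
have hk : h * k = 0 by rewrite /k mulrBr hr hh subrr.
have kh : k * h = 0 by rewrite /k mulrBl rh hh subrr.
have rk : r * k = k by rewrite /k mulrBr rr rh.
have kr : k * r = k by rewrite /k mulrBl rr hr.
have kk : idem k by rewrite /idem {1}/k mulrBl rk hk subr0.
have {}kE : k = r * (1 - x) * r * t.
  by rewrite [LHS]kE (mulrBr r 1 x) mulr1 (mulrBl r) rr.
set n := P + Q; set m := 1 - x.
have mx : m * x = 0 by rewrite /m mulrBl mul1r xx subrr.
have xm : x * m = 0 by rewrite /m mulrBr mulr1 xx subrr.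
(* Since [r = 1 - n] and [m x = 0], the product [m h] falls into the ideal of [n = P + Q]; the same
   holds for [x k] below. *)
have mh : m * h = - (m * n * x * r * s).
  rewrite hE (_ : r = 1 - n); last by rewrite one addrK.
  transitivity (m * x * (1 - n) * s - m * n * x * (1 - n) * s); first by ncring.
  by rewrite mx !mul0r add0r.
have xk : x * k = - (x * n * m * r * t).
  rewrite kE -/m (_ : r = 1 - n); last by rewrite one addrK.
  transitivity (x * m * (1 - n) * t - x * n * m * (1 - n) * t); first by ncring.
  by rewrite xm !mul0r add0r.
have khn : k + h + n = 1 by rewrite /k subrK /n -one.
(* Inserting [k + h + n = 1] after [m] in [x = a m c] splits [h] into [y1], which passes through
   [k], and [y2], which lies in the ideal of [n]. *)
set y1 := h * r * a * m * k * (c * r * s * h).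
set y2 := h * (r * a * (m * n - m * n * x * r * s) * (c * r * s)) * h.
have hy : h = y1 + y2.
  have hE' : h = r * (a * m * c) * r * s by rewrite -/m in xE; rewrite -xE.
  have mE : m = m * k + (m * n - m * n * x * r * s).
    by rewrite -mh -!mulrDr [n + h]addrC addrA khn mulr1.
  transitivity (h * (r * (a * (m * k + (m * n - m * n * x * r * s)) * c) * r * s) * h).
    by rewrite -mE -hE' !hh.
  by rewrite /y1 /y2; ncring.
have [|h1 [u [v [hh1 hh1' h1h h1E h1E']]]] := @corner_exchange h y1 ex hh.
  by rewrite /y1 !mulrA hh.
(* [al] and [be] factor [h1] through [k], so that [be al] is an idempotent under [k] equivalent to
   [h1]. *)
set al := h1 * h * r * a * m * k.
set be := k * (c * r * s * h * u * h1).
have ab : al * be = h1.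
  rewrite /al /be; transitivity (h1 * (h * r * a * m * (k * k) * (c * r * s * h) * u) * h1); first by ncring.
  by rewrite kk -/y1 -h1E hh1 hh1.
have al_l : h1 * al = al by rewrite /al !mulrA hh1.
have be_r : be * h1 = be by rewrite /be -!mulrA hh1.
have al_r : al * k = al by rewrite /al -mulrA kk.
have be_l : k * be = be by rewrite /be !mulrA kk.
set h' := be * al.
have hh' : idem h' by rewrite /idem /h' mulrA -(mulrA be) ab be_r.
have kh' : k * h' = h' by rewrite /h' mulrA be_l.
have h'k : h' * k = h' by rewrite /h' -mulrA al_r.
have Ph1 : P * h1 = 0 by rewrite -hh1' -rh !mulrA Pr !mul0r.
have Qh1 : Q * h1 = 0 by rewrite -hh1' -rh !mulrA Qr !mul0r.
have h1P : h1 * P = 0 by rewrite -h1h -hr -!mulrA rP !mulr0.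
have h1Q : h1 * Q = 0 by rewrite -h1h -hr -!mulrA rQ !mulr0.
have Ph' : P * h' = 0 by rewrite -kh' -rk !mulrA Pr !mul0r.
have Qh' : Q * h' = 0 by rewrite -kh' -rk !mulrA Qr !mul0r.
have h'P : h' * P = 0 by rewrite -h'k -kr -!mulrA rP !mulr0.
have h'Q : h' * Q = 0 by rewrite -h'k -kr -!mulrA rQ !mulr0.
have h1h' : h1 * h' = 0 by rewrite -h1h -kh' mulrA -(mulrA h1) hk mulr0 mul0r.
have h'h1 : h' * h1 = 0 by rewrite -h'k -hh1' mulrA -(mulrA h') kh mulr0 mul0r.
have IP'P : ideal1 (P + h1) P.
  by rewrite -[X in ideal _ X](_ : 1 * (P + h1) * P = P); [exact: idealG|rewrite mul1r mulrDl PP h1P addr0].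
have IP'h1 : ideal1 (P + h1) h1.
  by rewrite -[X in ideal _ X](_ : 1 * (P + h1) * h1 = h1); [exact: idealG|rewrite mul1r mulrDl hh1 Ph1 add0r].
have IQ'Q : ideal1 (Q + h') Q.
  by rewrite -[X in ideal _ X](_ : 1 * (Q + h') * Q = Q); [exact: idealG|rewrite mul1r mulrDl QQ h'Q addr0].
have IQ'h' : ideal1 (Q + h') h'.
  by rewrite -[X in ideal _ X](_ : 1 * (Q + h') * h' = h'); [exact: idealG|rewrite mul1r mulrDl hh' Qh' add0r].
have IP'Q : ideal1 (P + h1) Q by apply: ideal1_min IQ.
exists (P + h1), (Q + h'); split=> //.
- split.
  + by rewrite /idem mulrDl !mulrDr PP hh1 Ph1 h1P addr0 add0r.
  + by rewrite /idem mulrDl !mulrDr QQ hh' Qh' h'Q addr0 add0r.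
  + by rewrite mulrDl !mulrDr PQ Ph' h1Q h1h' !addr0.
  + by rewrite mulrDl !mulrDr QP Qh1 h'P h'h1 !addr0.
  + split; apply: idealD => //.
    * by rewrite -hh' /h' mulrA -(mulrA be) ab; apply: ideal_closed.
    * by apply: ideal1_min IP.
    * rewrite -hh1 -ab mulrA -(mulrA al) -/h'; exact: ideal_closed.
- have In : ideal1 (P + h1) n by apply: idealD.
  have Ih : ideal1 (P + h1) h.
    (* [h - h1] is a right multiple of [h - y1 = y2], hence in the ideal of [n]. *)
    rewrite -[h](subrK h1); apply: idealD => //.
    rewrite h1E' {1}hy [y1 + y2]addrC addrK; apply: ideal_mulr.
    rewrite /y2; apply: ideal_closed; apply: ideal_closed.
    by apply: idealB; do ?[exact: ideal_mull|apply: ideal_mulr].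
  have -> : x = x * h + x * n + x * k.
    by rewrite -!mulrDr addrC addrA khn mulr1.
  rewrite xk; apply: idealD; first by apply: idealD; exact: ideal_mull.
  by apply: idealN; do 3![apply: ideal_mulr]; exact: ideal_mull.
Qed.

Lemma halving_above x P Q : exchange ->
  ideal halvable x -> halving P Q ->
  exists P' Q', [/\ halving P' Q', ideal1 P' P & ideal1 P' x].
Proof.
move=> ex Ix; elim: Ix P Q => [|y z _ IHy _ IHz|a z c [zz z1]] P Q PQ.
- exists P, Q; split=> //; [exact: ideal1_refl|exact: ideal0].
- have [P1 [Q1 [PQ1 PP1 Py]]] := IHy _ _ PQ.
  have [P2 [Q2 [PQ2 PP2 Pz]]] := IHz _ _ PQ1.
  exists P2, Q2; split=> //; first exact: ideal1_min PP1.
  by apply: idealD => //; exact: ideal1_min Py.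
- have [P1 [Q1 [PQ1 PP1 Pz]]] := merge ex PQ zz z1.
  by exists P1, Q1; split=> //; exact: ideal_closed.
Qed.

(** Absorbing 1 from the pair [(0, 0)] makes [P] full, hence also [Q]; and [Q = (1 - P) Q] makes
    [1 - P] full. *)
Lemma exchange_full_halving : exchange ->
  ideal halvable 1 ->
  exists P, [/\ idem P, ideal1 P 1 & ideal1 (1 - P) 1].
Proof.
move=> ex I1; have H0 : halving 0 0.
  by split; rewrite /idem ?mulr0 //; split; exact: ideal0.
have [P [Q [[PP _ PQ _ [_ IP]] _ IP1]]] := halving_above ex I1 H0.
exists P; split=> //; apply: ideal1_min IP1; apply: ideal1_min IP.
by rewrite -[X in ideal _ X](_ : 1 * (1 - P) * Q = Q); [exact: idealG|rewrite mul1r mulrBl mul1r PQ subr0].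
Qed.

Lemma full_partition z P : exchange -> idem P -> ideal1 z 1 ->
  exists b : seq A, [/\ orth_idems b, P = \sum_(x <- b) x &
    forall x, x \in b -> subequiv z x].
Proof.
move=> ex PP zP; have /ideal1_sum[s [Ss Ps]] : ideal1 z P.
  by rewrite -[P]mulr1; exact: ideal_mull.
exact: multi_exchange ex (@subequiv_closed z) PP Ss Ps.
Qed.

End RingTheory.

(** * Products of commutators *)

(** Cutting the two coefficients by the idempotents puts them in [xAq] and [qAx]. They form one pair
    so that [choice] can select them for a whole family. *)
Lemma subequivP (A : nzRingType) (q x : A) : idem q -> idem x -> subequiv q x ->
  exists uw : A * A, [/\ uw.1 * uw.2 = x, x * uw.1 = uw.1, uw.1 * q = uw.1,
    q * uw.2 = uw.2 & uw.2 * x = uw.2].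
Proof.
move=> qq xx [a [c xE]]; exists (x * a * q, q * c * x); split=> /=.
- by rewrite -!mulrA (mulrA q q) qq !mulrA -(mulrA x a) -(mulrA x) -xE xx xx.
- by rewrite !mulrA xx.
- by rewrite -mulrA qq.
- by rewrite !mulrA qq.
- by rewrite -mulrA xx.
Qed.

Lemma idemC (A : nzRingType) (q : A) : idem q -> idem (1 - q).
Proof. by move=> qq; rewrite /idem mulrBr mulr1 mulrBl mul1r qq subrr subr0. Qed.

Section CommutatorAlgebra.
Variables (K : numFieldType) (A : algType K).
Implicit Types (x y c P Q : A) (b p : seq A).

Definition offdiag p y := forall x, x \in p -> x * y * x = 0.

Definition is_commr x := exists c d : A, x = commr c d.

Lemma is_commr_conj (g g' x : A) : g' * g = 1 -> is_commr x -> is_commr (g * x * g').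
Proof.
move=> gg [c [d ->]]; exists (g * c * g'), (g * d * g'); rewrite /commr.
transitivity (g * c * 1 * d * g' - g * d * 1 * c * g'); first by ncring.
by rewrite -gg; ncring.
Qed.

(** The commutator with [D], the sum of the multiples [i p_i], multiplies the block [(i, j)] by
    [i - j], which is invertible off the diagonal in characteristic zero. *)
Lemma offdiag_commr p y : orth_idems p -> \sum_(x <- p) x = 1 -> offdiag p y ->
  is_commr y.
Proof.
move=> op p1 oy; set n := size p.
have p1' : \sum_(i < n) p`_i = 1 by rewrite -p1 (big_nth 0) big_mkord.
pose D := \sum_(i < n) (i%:R : K) *: p`_i.
(* For [i = j] the inverse of 0 is 0, which is right because that block of [y] vanishes. *)
pose z := \sum_(i < n) \sum_(j < n) ((i%:R - j%:R : K)^-1) *: (p`_i * y * p`_j).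
have Dp (i : 'I_n) : D * p`_i = (i%:R : K) *: p`_i.
  rewrite mulr_suml (bigD1 i) //= -scalerAl op eqxx big1 ?addr0 // => j ji.
  by rewrite -scalerAl op -val_eqE /= in ji *; rewrite (negbTE ji) scaler0.
have pD (i : 'I_n) : p`_i * D = (i%:R : K) *: p`_i.
  rewrite mulr_sumr (bigD1 i) //= -scalerAr op eqxx big1 ?addr0 // => j ji.
  rewrite -scalerAr op; rewrite -val_eqE /= eq_sym in ji.
  by rewrite (negbTE ji) scaler0.
exists D, z; rewrite /commr mulr_sumr mulr_suml -sumrB.
have yE : y = \sum_(i < n) \sum_(j < n) p`_i * y * p`_j.
  rewrite -[LHS]mulr1 -[y in LHS]mul1r -p1' !mulr_suml; apply: eq_bigr => i _.
  by rewrite mulr_sumr.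
rewrite [LHS]yE; apply: eq_bigr => i _; rewrite mulr_sumr mulr_suml -sumrB; apply: eq_bigr => j _.
rewrite -scalerAr -scalerAl -scalerBr !mulrA Dp -(mulrA _ _ D) pD.
rewrite -!scalerAl -scalerAr -scalerBl scalerA.
have [->|ij] := eqVneq i j; last first.
  by rewrite mulVf ?scale1r // subr_eq0 eqr_nat.
by rewrite oy ?scaler0 // mem_nth.
Qed.

(* [Y = P - U - W U] works: conjugating it by [1 + W] makes it off-diagonal. *)
Lemma commr_fixing b P : orth_idems b -> P = \sum_(x <- b) x ->
  (forall x, x \in b -> subequiv (1 - P) x) ->
  exists Y, is_commr Y /\ Y * P = P.
Proof.
move=> ob bP Pb; set Q := 1 - P; set n := size b.
have PP : idem P by rewrite bP; exact: orth_idems_idem.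
have QP : Q * P = 0 by rewrite mulrBl mul1r PP subrr.
have PQ : P * Q = 0 by rewrite mulrBr mulr1 PP subrr.
have QQ : idem Q by exact: idemC.
have Pbi i : P * b`_i = b`_i by rewrite bP orth_idems_suml.
have biP i : b`_i * P = b`_i by rewrite bP orth_idems_sumr.
have Qbi i : Q * b`_i = 0 by rewrite mulrBl mul1r Pbi subrr.
have biQ i : b`_i * Q = 0 by rewrite mulrBr mulr1 biP subrr.
have bP' : P = \sum_(i < n) b`_i by rewrite bP (big_nth 0) big_mkord.
have [|uw uwP] := choice (P := fun (i : 'I_n) (uw : A * A) =>
    [/\ uw.1 * uw.2 = b`_i, b`_i * uw.1 = uw.1, uw.1 * Q = uw.1,
      Q * uw.2 = uw.2 & uw.2 * b`_i = uw.2]).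
  move=> i; apply: subequivP => //; last by apply: Pb; rewrite mem_nth.
  by rewrite /idem ob eqxx.
set U := \sum_(i < n) (uw i).1; set W := \sum_(i < n) (uw i).2.
have UQ : U * Q = U by rewrite mulr_suml; apply: eq_bigr => i _; case: (uwP i).
have QW : Q * W = W by rewrite mulr_sumr; apply: eq_bigr => i _; case: (uwP i).
have biU (i : 'I_n) : b`_i * U = (uw i).1.
  rewrite mulr_sumr (bigD1 i) //= big1 ?addr0; first by case: (uwP i).
  move=> j ji; have [_ <- _ _ _] := uwP j.
  by rewrite mulrA ob; rewrite -val_eqE /= eq_sym in ji; rewrite (negbTE ji) mul0r.
have Wbi (i : 'I_n) : W * b`_i = (uw i).2.
  rewrite mulr_suml (bigD1 i) //= big1 ?addr0; first by case: (uwP i).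
  move=> j ji; have [_ _ _ _ <-] := uwP j.
  by rewrite -mulrA ob; rewrite -val_eqE /= in ji; rewrite (negbTE ji) mulr0.
have PU : P * U = U.
  by rewrite {1}bP' mulr_suml; apply: eq_bigr => i _; rewrite biU.
have WP : W * P = W.
  by rewrite {1}bP' mulr_sumr; apply: eq_bigr => i _; rewrite Wbi.
have QU : Q * U = 0 by rewrite -PU mulrA QP mul0r.
have WQ : W * Q = 0 by rewrite -WP -mulrA PQ mulr0.
have UP : U * P = 0 by rewrite -UQ -mulrA QP mulr0.
have PW : P * W = 0 by rewrite -QW mulrA PQ mul0r.
have WW : W * W = 0 by rewrite -{1}WP -mulrA PW mulr0.
(* The diagonal block of [P] at each entry of [b] is cancelled by that of [U W], while [U] and [W]
   have no diagonal blocks. *)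
set T := P - U * W - U - W.
have oT : offdiag (Q :: b) T.
  move=> x; rewrite inE => /orP[/eqP ->|/(nthP 0)[i ib <-]].
    transitivity ((Q * P) * Q - (Q * U) * W * Q - Q * U * Q - Q * (W * Q)); first by rewrite /T; ncring.
    by rewrite QP QU WQ !mul0r mulr0 !subr0.
  have [uwi _ uQ Qw _] := uwP (Ordinal ib); rewrite /= in uwi uQ Qw.
  have bU := biU (Ordinal ib); have Wb := Wbi (Ordinal ib); rewrite /= in bU Wb.
  transitivity (b`_i * P * b`_i - (b`_i * U) * (W * b`_i) - b`_i * U * b`_i - b`_i * (W * b`_i)).
    by rewrite /T; ncring.
  rewrite biP ob eqxx bU Wb uwi subrr -uQ -(mulrA _ Q) Qbi -Qw (mulrA _ Q) biQ.
  by rewrite mul0r mulr0 !subr0.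
exists ((1 + W) * T * (1 - W)); split.
- apply: is_commr_conj.
    by transitivity (1 - W * W); [ncring|rewrite WW subr0].
  apply: (@offdiag_commr (Q :: b)) => //; last by rewrite big_cons -bP subrK.
  by move=> [|i] [|j] //=; rewrite ?eqSS.
- transitivity ((1 + W) * (P * P - U * (W * P) - U * P - W * P - (P * W) * P + U * (W * W) * P + U * (W * P) + (W * W) * P)).
    by rewrite /T; ncring.
  rewrite PP WP UP WW PW !mul0r mulr0 mul0r !addr0 !subr0.
  transitivity (P + W * P - W - W * W); first by ncring.
  by rewrite WP WW addrK subr0.
Qed.

(** With [p_i = u_i w_i] through [1 - p_i], both [U] and [W d] have zero diagonal blocks, yet the
    block of [U W d] at [p_i] is [u_i w_i x p_i = p_i x p_i]. *)
Lemma diag_product p x : orth_idems p -> \sum_(y <- p) y = 1 ->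
  (forall y, y \in p -> subequiv (1 - y) y) ->
  exists U V, [/\ is_commr U, is_commr V & offdiag p (x - U * V)].
Proof.
move=> op p1 pp; set n := size p.
have p1' : \sum_(i < n) p`_i = 1 by rewrite -p1 (big_nth 0) big_mkord.
have ii i : idem p`_i by rewrite /idem op eqxx.
have [|uw uwP] := choice (P := fun (i : 'I_n) (uw : A * A) =>
    [/\ uw.1 * uw.2 = p`_i, p`_i * uw.1 = uw.1, uw.1 * (1 - p`_i) = uw.1,
      (1 - p`_i) * uw.2 = uw.2 & uw.2 * p`_i = uw.2]).
  by move=> i; apply: subequivP; [exact: idemC|exact: ii|apply: pp; rewrite mem_nth].
set U := \sum_(i < n) (uw i).1; set W := \sum_(i < n) (uw i).2.
set d := \sum_(i < n) p`_i * x * p`_i.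
have pU (i : 'I_n) : p`_i * U = (uw i).1.
  rewrite mulr_sumr (bigD1 i) //= big1 ?addr0; first by case: (uwP i).
  move=> j ji; have [_ <- _ _ _] := uwP j.
  by rewrite mulrA op; rewrite -val_eqE /= eq_sym in ji; rewrite (negbTE ji) mul0r.
have Wp (i : 'I_n) : W * p`_i = (uw i).2.
  rewrite mulr_suml (bigD1 i) //= big1 ?addr0; first by case: (uwP i).
  move=> j ji; have [_ _ _ _ <-] := uwP j.
  by rewrite -mulrA op; rewrite -val_eqE /= in ji; rewrite (negbTE ji) mulr0.
have dp (i : 'I_n) : d * p`_i = p`_i * x * p`_i.
  rewrite mulr_suml (bigD1 i) //= -!mulrA op eqxx big1 ?addr0 // => j ji.
  by rewrite -!mulrA op; rewrite -val_eqE /= in ji; rewrite (negbTE ji) !mulr0.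
have up (i : 'I_n) : (uw i).1 * p`_i = 0.
  by have [_ _ <- _ _] := uwP i; rewrite -mulrA mulrBl mul1r ii subrr mulr0.
have pw (i : 'I_n) : p`_i * (uw i).2 = 0.
  by have [_ _ _ <- _] := uwP i; rewrite mulrA mulrBr mulr1 ii subrr mul0r.
have Wdp (i : 'I_n) : W * d * p`_i = (uw i).2 * x * p`_i.
  by rewrite -mulrA dp !mulrA Wp.
have memp y : y \in p -> exists i : 'I_n, y = p`_i.
  by case/(nthP 0)=> i ip <-; exists (Ordinal ip).
exists U, (W * d); split.
- apply: (offdiag_commr op p1) => _ /memp[i ->].
  by rewrite pU up.
- apply: (offdiag_commr op p1) => _ /memp[i ->].
  by rewrite -mulrA Wdp !mulrA pw !mul0r.
- move=> _ /memp[i ->]; have [uwi _ _ _ _] := uwP i.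
  rewrite mulrBr mulrBl (mulrA p`_i U) pU -[_ * (W * d) * _]mulrA.
  by rewrite Wdp !mulrA uwi subrr.
Qed.

Lemma full_halving_commr P : exchange A -> idem P ->
  ideal (eq P) 1 -> ideal (eq (1 - P)) 1 ->
  forall x, exists U V c, [/\ is_commr U, is_commr V & is_commr c] /\
    [/\ x = U * V + c & exists Y Z d e,
      [/\ is_commr Y, is_commr Z, is_commr d & is_commr e] /\ c = Y * d + Z * e].
Proof.
move=> ex PP P1 Q1 x; set Q := 1 - P; have QQ : idem Q by exact: idemC.
have PQ : P * Q = 0 by rewrite mulrBr mulr1 PP subrr.
have QP : Q * P = 0 by rewrite mulrBl mul1r PP subrr.
have PQ1 : P + Q = 1 by rewrite /Q addrC subrK.
have [b [ob bP Qb]] := full_partition ex PP Q1.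
have [b' [ob' bQ Pb']] := full_partition ex QQ P1.
have op : orth_idems (b ++ b') by apply: orth_idems_cat; rewrite // -bP -bQ.
have p1 : \sum_(y <- b ++ b') y = 1 by rewrite big_cat -bP -bQ.
have Pb y : y \in b -> y * P = y /\ P * y = y.
  by case/(nthP 0)=> i _ <-; rewrite bP orth_idems_suml ?orth_idems_sumr.
have Qb' y : y \in b' -> y * Q = y /\ Q * y = y.
  by case/(nthP 0)=> i _ <-; rewrite bQ orth_idems_suml ?orth_idems_sumr.
have [|U [V [cU cV oc]]] := @diag_product (b ++ b') x op p1.
  move=> y; rewrite mem_cat => /orP[yb|yb'].
  - have [_ Py] := Pb _ yb; have [a [c yE]] := Qb _ yb.
    (* [Q] lies under [1 - y], so a factorisation of [y] through [Q] is also one through [1 - y]. *)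
    have Qy : Q * (1 - y) = Q by rewrite mulrBr mulr1 -Py mulrA QP mul0r subr0.
    by exists (a * Q), c; rewrite -(mulrA a) Qy.
  - have [_ Qy] := Qb' _ yb'; have [a [c yE]] := Pb' _ yb'.
    have Py : P * (1 - y) = P by rewrite mulrBr mulr1 -Qy mulrA PQ mul0r subr0.
    by exists (a * P), c; rewrite -(mulrA a) Py.
have [Y [cY YP]] := commr_fixing ob bP Qb.
have [|Z [cZ ZQ]] := commr_fixing ob' bQ.
  by rewrite /Q opprB addrC subrK.
exists U, V, (x - U * V); split; first by split=> //; exact: offdiag_commr oc.
split; first by rewrite addrC subrK.
(* Each idempotent of the partition lies under [P] or under [Q], so multiplication by [P] or [Q]
   keeps or kills a diagonal block and preserves off-diagonality. *)
exists Y, Z, (P * (x - U * V)), (Q * (x - U * V)); split.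
  split=> //; apply: (offdiag_commr op p1) => y yp; rewrite mulrA.
  - have [->|->] : y * P = y \/ y * P = 0.
      move: yp; rewrite mem_cat => /orP[/Pb[]|/Qb'[<- _]]; first by left.
      by right; rewrite -mulrA QP mulr0.
    + exact: oc.
    + by rewrite !mul0r.
  - have [->|->] : y * Q = y \/ y * Q = 0.
      move: yp; rewrite mem_cat => /orP[/Pb[<- _]|/Qb'[]]; last by left.
      by right; rewrite -mulrA PQ mulr0.
    + exact: oc.
    + by rewrite !mul0r.
by rewrite !mulrA YP ZQ -mulrDl PQ1 mul1r.
Qed.

End CommutatorAlgebra.

(** * Banach algebra preliminaries *)

Lemma bernoulli (R : realFieldType) (x : R) n : 0 <= x -> 1 + n%:R * (x - 1) <= x ^+ n.
Proof.
move=> x0; elim: n => [|n IHn]; first by rewrite mul0r addr0 expr0.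
rewrite exprS; apply: le_trans (ler_wpM2l x0 IHn).
have : 0 <= (x - 1) ^+ 2 by exact: sqr_ge0.
have : 0 <= n%:R :> R by exact: ler0n.
rewrite -[in n.+1%:R]natr1 => n0 sq.
have -> : x * (1 + n%:R * (x - 1)) = 1 + (n%:R + 1) * (x - 1) + n%:R * (x - 1) ^+ 2 by ring.
by rewrite lerDl mulr_ge0.
Qed.

(** This replaces the extraction of [m]-th roots: by Bernoulli, powers of a number above 1 grow at
    least linearly. *)
Lemma expr_bounded_le1 (R : realType) (x M : R) : 0 <= x ->
  (forall n : nat, exists2 m : nat, (n <= m)%N & x ^+ m <= M) -> x <= 1.
Proof.
move=> x0 xM; rewrite leNgt; apply/negP => x1.
have d0 : 0 < x - 1 by rewrite subr_gt0.
set n := Num.bound (`|M| / (x - 1)).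
have [m nm] := xM n; apply/negP; rewrite -ltNge.
apply: lt_le_trans (bernoulli m x0).
apply: (@lt_trans _ _ (m%:R * (x - 1))); last by rewrite ltrDr ltr01.
apply: (@le_lt_trans _ _ `|M|); first exact: ler_norm.
rewrite -ltr_pdivrMr //; apply: lt_le_trans (archi_boundP _) _.
  by rewrite divr_ge0 // ltW.
by rewrite ler_nat.
Qed.

Lemma expr_small (R : realType) (x e : R) : 0 <= x -> x < 1 -> 0 < e ->
  exists N, forall n, (N <= n)%N -> x ^+ n < e.
Proof.
move=> x0 x1 e0; rewrite le0r in x0; case/orP: x0 => [/eqP ->|x0].
  by exists 1%N => -[//|n] _; rewrite expr0n.
have [N xN] : exists N, x ^+ N < e.
  apply: contrapT => /forallNP H.
  suff : x^-1 <= 1 by rewrite invf_le1 // leNgt x1.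
  apply: (@expr_bounded_le1 _ _ e^-1); first by rewrite invr_ge0 ltW.
  move=> n; exists n => //; rewrite exprVn lef_pV2 ?posrE ?exprn_gt0 //.
  by rewrite leNgt; apply/negP/H.
exists N => n Nn; apply: le_lt_trans xN.
by rewrite -(subnK Nn) exprD ler_piMl ?exprn_ge0 ?exprn_ile1 ?ltW.
Qed.

Lemma normc_real (R : rcfType) (r : R) : ComplexField.Normc.normc (r%:C)%C = `|r|.
Proof. by rewrite /ComplexField.Normc.normc /= expr0n /= addr0 sqrtr_sqr. Qed.

(** * Norm and involution, real scalars, Neumann series *)

Section BanachStarAlgebra.
Variables (R : realType) (A : algType R[i]) (star : A -> A) (nrm : A -> R).
Hypothesis hA : is_unital_cstar star nrm.
Implicit Types (a b c d e m p q u v w x y z : A) (r t : R).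

(** Keeping real scalars as central elements of [A] makes identities that contain them pure ring
    identities, within reach of [ncring]. *)
Definition real_scalar r : A := (r%:C)%C%:A.

Local Notation rsc := real_scalar.

Lemma rscE r x : (r%:C)%C *: x = rsc r * x.
Proof. by rewrite /rsc -scalerAl mul1r. Qed.
Lemma rscC r x : x * rsc r = rsc r * x.
Proof. by rewrite /rsc -scalerAl mul1r -scalerAr mulr1. Qed.
Lemma rscD r t : rsc (r + t) = rsc r + rsc t.
Proof. by rewrite /rsc rmorphD scalerDl. Qed.
Lemma rscN r : rsc (- r) = - rsc r.
Proof. by rewrite /rsc rmorphN scaleNr. Qed.
Lemma rscB r t : rsc (r - t) = rsc r - rsc t.
Proof. by rewrite rscD rscN. Qed.
Lemma rscM r t : rsc (r * t) = rsc r * rsc t.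
Proof. by rewrite -rscE /rsc scalerA rmorphM. Qed.
Lemma rsc1 : rsc 1 = 1.
Proof. by rewrite /rsc rmorph1 scale1r. Qed.
Lemma rsc0 : rsc 0 = 0.
Proof. by rewrite /rsc rmorph0 scale0r. Qed.

Lemma nrm_ge0' x : 0 <= nrm x. Proof. exact: nrm_ge0 hA x. Qed.
Hint Resolve nrm_ge0' : core.

Lemma nrm_rscM r x : nrm (rsc r * x) = `|r| * nrm x.
Proof. by rewrite -rscE (nrm_scale hA) normc_real. Qed.
Lemma nrm_rsc r : nrm (rsc r) = `|r|.
Proof. by rewrite -[rsc r]mulr1 nrm_rscM (nrm_one hA) mulr1. Qed.
Lemma nrm0 : nrm 0 = 0.
Proof. by rewrite -rsc0 nrm_rsc normr0. Qed.
Lemma nrmN x : nrm (- x) = nrm x.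
Proof. by rewrite -mulN1r -rsc1 -rscN nrm_rscM normrN normr1 mul1r. Qed.
Lemma nrmD x y : nrm (x + y) <= nrm x + nrm y. Proof. exact: nrm_triangle hA x y. Qed.
Lemma nrmM x y : nrm (x * y) <= nrm x * nrm y. Proof. exact: nrm_submul hA x y. Qed.
Lemma nrmB x y : nrm (x - y) <= nrm x + nrm y.
Proof. by rewrite -[nrm y]nrmN; exact: nrmD. Qed.
Lemma nrmBC x y : nrm (x - y) = nrm (y - x).
Proof. by rewrite -nrmN opprB. Qed.
Lemma nrmBt x y z : nrm (x - z) <= nrm (x - y) + nrm (y - z).
Proof. by apply: le_trans (nrmD _ _); rewrite addrA subrK. Qed.
Lemma nrmX x n : nrm (x ^+ n) <= nrm x ^+ n.
Proof.
elim: n => [|n IHn]; first by rewrite !expr0 (nrm_one hA).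
by rewrite !exprS; apply: le_trans (nrmM _ _) _; exact: ler_wpM2l.
Qed.
Lemma nrm_sum (I : Type) (s : seq I) (P : pred I) (F : I -> A) :
  nrm (\sum_(i <- s | P i) F i) <= \sum_(i <- s | P i) nrm (F i).
Proof.
elim/big_ind2: _ => [|x r y t xr yt|i _]; rewrite ?nrm0 //.
by apply: le_trans (nrmD _ _) _; exact: lerD.
Qed.

Lemma nrm_small0 x : (forall r, 0 < r -> nrm x <= r) -> x = 0.
Proof.
move=> xr; apply: (nrm_eq0 hA); apply/eqP; rewrite eq_le nrm_ge0' andbT.
rewrite leNgt; apply/negP => x0; have := xr (nrm x / 2); rewrite divr_gt0 //.
by move=> /(_ isT); move: x0; lra.
Qed.

Lemma starN x : star (- x) = - star x.
Proof.
have := star_scale hA (- 1) x; rewrite scaleN1r => ->.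
by rewrite rmorphN rmorph1 scaleN1r.
Qed.
Lemma starB x y : star (x - y) = star x - star y.
Proof. by rewrite (star_add hA) starN. Qed.
Lemma star0 : star 0 = 0.
Proof. by rewrite -(subrr 0) starB !subrr. Qed.
Lemma star1 : star 1 = 1.
Proof.
have := star_mul hA 1 (star 1); by rewrite mul1r !(star_invol hA) mul1r.
Qed.
Lemma star_rsc r : star (rsc r) = rsc r.
Proof. by rewrite /rsc (star_scale hA) star1 conjc_real. Qed.
Lemma star_rscM r x : star (rsc r * x) = rsc r * star x.
Proof. by rewrite (star_mul hA) star_rsc rscC. Qed.
Lemma star_sum (I : Type) (s : seq I) (P : pred I) (F : I -> A) :
  star (\sum_(i <- s | P i) F i) = \sum_(i <- s | P i) star (F i).
Proof. by apply: (big_morph star (star_add hA) star0). Qed.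
Lemma nrm_star_le x : nrm x <= nrm (star x).
Proof.
have := nrmM (star x) x; rewrite (cstar_identity hA) expr2.
have [->|x0] := eqVneq (nrm x) 0; first by [].
by rewrite ler_pM2r // lt_def x0 /=.
Qed.
Lemma nrm_star x : nrm (star x) = nrm x.
Proof.
by apply/eqP; rewrite eq_le nrm_star_le andbT -{2}[x](star_invol hA) nrm_star_le.
Qed.
Lemma nrm_mul_star x : nrm (x * star x) = nrm x ^+ 2.
Proof. by rewrite -[nrm x]nrm_star -(cstar_identity hA) (star_invol hA). Qed.

Local Notation sa := (self_adjoint star).

Lemma saX x n : sa x -> sa (x ^+ n).
Proof.
move=> sx; elim: n => [|n IHn]; first exact: star1.
by rewrite /self_adjoint exprS (star_mul hA) IHn sx -exprSr exprS.
Qed.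
(** For self-adjoint elements the C*-identity says that squaring squares the norm. *)
Lemma sa_nrmX x k : sa x -> nrm (x ^+ (2 ^ k)) = nrm x ^+ (2 ^ k).
Proof.
move=> sx; elim: k => [|k IHk]; first by rewrite !expr1.
rewrite expnSr !exprM -IHk -(cstar_identity hA) expr2; congr (nrm (_ * _)).
by rewrite saX.
Qed.

Section Neumann.
Variable m : A.
Hypothesis m1 : nrm m < 1.
Let S n := \sum_(i < n) m ^+ i.

Let S_S n : S n.+1 = 1 + m * S n.
Proof.
by rewrite /S big_ord_recl expr0 mulr_sumr; congr (_ + _); apply: eq_bigr => i _; rewrite -exprS.
Qed.

Let mS n : m * S n = S n * m.
Proof.
by rewrite mulr_sumr mulr_suml; apply: eq_bigr => i _; rewrite -exprS -exprSr.
Qed.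

Let S_bound n : nrm (S n) <= (1 - nrm m)^-1.
Proof.
have d0 : 0 < 1 - nrm m by rewrite subr_gt0.
elim: n => [|n IHn]; first by rewrite /S big_ord0 nrm0 invr_ge0 ltW.
rewrite S_S; apply: le_trans (nrmD _ _) _; rewrite (nrm_one hA).
have -> : (1 - nrm m)^-1 = 1 + nrm m * (1 - nrm m)^-1 by field; rewrite gt_eqF.
by rewrite lerD2l; apply: le_trans (nrmM _ _) _; apply: ler_wpM2l.
Qed.

Let S_diff n k : nrm (S (n + k) - S n) <= nrm m ^+ n * (1 - nrm m)^-1.
Proof.
have -> : S (n + k) - S n = m ^+ n * S k.
  rewrite /S big_split_ord /= addrAC subrr add0r mulr_sumr.
  by apply: eq_bigr => i _; rewrite exprD.
by apply: le_trans (nrmM _ _) _; apply: ler_pM => //; exact: nrmX.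
Qed.

Lemma neumann : invertible (1 - m).
Proof.
have d0 : 0 < 1 - nrm m by rewrite subr_gt0.
have small (r : R) : 0 < r -> exists N, forall n, (N <= n)%N -> nrm m ^+ n < r.
  by move=> r0; exact: expr_small.
have [|l lS] := nrm_complete hA (u := S).
  move=> r r0; have [|N mN] := small (r * (1 - nrm m)); first exact: mulr_gt0.
  exists N; have H i j : (N <= i)%N -> (i <= j)%N -> nrm (S j - S i) < r.
    move=> Ni ij; rewrite -(subnKC ij); apply: le_lt_trans (S_diff _ _) _.
    by rewrite ltr_pdivrMr //; exact: mN.
  move=> i j Ni Nj; have [ij|ji] := leqP i j; first by rewrite nrmBC H.
  by apply: H => //; exact: ltnW.
(* Serves both one-sided inverses: [f] is multiplication by [1 - m] on either side, and 2 bounds the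
   norm of [1 - m]. *)
have key (x : A) (f : A -> A) : (forall y, nrm (f y) <= 2 * nrm y) ->
    (forall n, x = f (l - S n) - m ^+ n) -> x = 0.
  move=> f2 xE; apply: nrm_small0 => r r0.
  have [|N1 HN1] := lS (r / 4); first by rewrite divr_gt0.
  have [|N2 HN2] := small (r / 2); first by rewrite divr_gt0.
  have := HN1 (maxn N1 N2) (leq_maxl _ _); have := HN2 (maxn N1 N2) (leq_maxr _ _).
  rewrite (xE (maxn N1 N2)) nrmBC; set n := maxn _ _ => h2 h1.
  have := nrmB (f (l - S n)) (m ^+ n); have := nrmX m n; have := f2 (l - S n).
  by move: h1 h2; lra.
have n2 : nrm (1 - m) <= 2 by have := nrmB 1 m; rewrite (nrm_one hA); move: m1; lra.
have Sn n : (1 - m) * S n = 1 - m ^+ n.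
  have E : S n + m ^+ n = 1 + m * S n by rewrite -S_S /S big_ord_recr.
  transitivity ((S n + m ^+ n) - m * S n - m ^+ n); first by ncring.
  by rewrite E; ncring.
exists l; split; apply/eqP; rewrite -subr_eq0; apply/eqP.
- apply: (key _ (fun y => (1 - m) * y)) => [y|n].
    by apply: le_trans (nrmM _ _) _; exact: ler_wpM2r.
  by rewrite mulrBr Sn; ncring.
- apply: (key _ (fun y => y * (1 - m))) => [y|n].
    by apply: le_trans (nrmM _ _) _; rewrite mulrC; exact: ler_wpM2r.
  have Sn' : S n * (1 - m) = 1 - m ^+ n by rewrite mulrBr mulr1 -mS -{1}[S n]mul1r -mulrBl Sn.
  by rewrite mulrBl Sn'; ncring.
Qed.

End Neumann.

Lemma near1_invertible w : nrm (1 - w) < 1 -> invertible w.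
Proof. by move=> /neumann; rewrite opprB addrC subrK. Qed.

Lemma invertibleM x y : invertible x -> invertible y -> invertible (x * y).
Proof.
move=> [x' [xx' x'x]] [y' [yy' y'y]]; exists (y' * x'); split.
  by rewrite mulrA -(mulrA x) yy' mulr1.
by rewrite mulrA -(mulrA y') x'x mulr1.
Qed.

Lemma invertible_rsc r : r != 0 -> invertible (rsc r).
Proof. by move=> r0; exists (rsc r^-1); rewrite -!rscM ?mulfV ?mulVf // rsc1. Qed.

Lemma near_rsc_invertible r w : nrm (rsc r - w) < r -> invertible w.
Proof.
move=> wr; have r0 : 0 < r by apply: le_lt_trans wr.
have -> : w = rsc r * (rsc r^-1 * w) by rewrite mulrA -rscM mulfV ?gt_eqF // rsc1 mul1r.
apply: invertibleM; first by apply: invertible_rsc; rewrite gt_eqF.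
apply: near1_invertible; have -> : 1 - rsc r^-1 * w = rsc r^-1 * (rsc r - w).
  by rewrite mulrBr -rscM mulVf ?gt_eqF // rsc1.
rewrite nrm_rscM gtr0_norm ?invr_gt0 // mulrC ltr_pdivrMr //.
by rewrite mul1r.
Qed.

Lemma near_rsc_inverse r w y : w * y = 1 -> (r - nrm (rsc r - w)) * nrm y <= 1.
Proof.
move=> wy; have H : rsc r * y = (rsc r - w) * y + 1 by rewrite mulrBl wy subrK.
have := nrm_rscM r y; rewrite H => E.
have := nrmD ((rsc r - w) * y) 1; have := nrmM (rsc r - w) y.
have := ler_wpM2r (nrm_ge0' y) (ler_norm r); rewrite E (nrm_one hA); lra.
Qed.

End BanachStarAlgebra.

(** * Self-adjoint elements of finite spectrum *)

(** Compactness of the interval: the supremum of the [t] with [B a t] could be passed by a local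
    step if it were below [b]. *)
Lemma interval_induction (R : realType) (B : R -> R -> Prop) (a b : R) : a <= b ->
  (forall x y z, x <= y -> y <= z -> B x y -> B y z -> B x z) ->
  (forall x, exists2 d, 0 < d & forall y z, x - d <= y -> y <= z -> z <= x + d -> B y z) ->
  B a b.
Proof.
move=> ab Bcat Bloc.
pose S := [set t : R | [/\ a <= t, t <= b & B a t]]%classic.
have Sa : S a.
  split=> //; have [d d0 Bd] := Bloc a; apply: Bd => //.
    by rewrite gerBl ltW.
  by rewrite lerDl ltW.
have hS : has_sup S by split; [exists a | exists b => t []].
have [d d0 Bd] := Bloc (sup S).
have [t [at_ tb Bat] tS] := sup_adherent d0 hS.
have ts : t <= sup S by apply: (sup_upper_bound hS); split.
have sb : sup S <= b by apply: ge_sup; [exists a | move=> ? []].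
pose u := Num.min b (sup S + d).
have tu : t <= u by rewrite le_min tb; move: ts d0; lra.
have Su : S u.
  split; [exact: le_trans tu|by rewrite ge_min lexx|].
  apply: (Bcat _ t) => //; apply: Bd => //; first by rewrite ltW.
  by rewrite ge_min lexx orbT.
have : u <= sup S by exact: (sup_upper_bound hS).
rewrite ge_min => /orP[bs|]; last by move: d0; lra.
have : u = b by apply/min_idPl; move: bs d0; lra.
by move=> <-; case: Su.
Qed.

Lemma normc_re_im (R : rcfType) (x y : R) :
  ComplexField.Normc.normc (Complex x y) <= `|x| + `|y|.
Proof.
have -> : Complex x y = Complex x 0 + Complex 0 y :> R[i].
  by apply/eqP; rewrite eq_complex /= addr0 add0r !eqxx.
apply: le_trans (le_normcD _ _) _.
by rewrite /ComplexField.Normc.normc /= !expr0n /= addr0 add0r !sqrtr_sqr.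
Qed.

(** * Self-adjoint elements whose resolvent exists everywhere *)

Section QuasiNilpotent.
Variables (R : realType) (A : algType R[i]) (star : A -> A) (nrm : A -> R).
Hypothesis hA : is_unital_cstar star nrm.
Local Notation normc := ComplexField.Normc.normc.
Local Notation sa := (self_adjoint star).
Let nrm_nonneg x : 0 <= nrm x. Proof. exact: nrm_ge0' hA x. Qed.
Local Hint Resolve nrm_nonneg : core.

Definition inverse_of (x y : A) := x * y = 1 /\ y * x = 1.

Lemma resolvent_eq (c : A) (z z' : R[i]) y y' : inverse_of (1 - z *: c) y ->
  inverse_of (1 - z' *: c) y' -> y - y' = (z - z') *: (y' * c * y).
Proof.
move=> [zy _] [_ y'z].
have -> : (z - z') *: (y' * c * y) = y' * (z *: c - z' *: c) * y.
  by rewrite -scalerBl -scalerAr -scalerAl.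
transitivity (y' * (1 - z' *: c) * y - y' * ((1 - z *: c) * y)).
  by rewrite y'z zy mul1r mulr1.
by ncring.
Qed.

(** The resolvent identity bounds the norm of [y - y'] by half the norm of [y]. *)
Lemma resolvent_locally_bounded (c : A) (z z' : R[i]) y y' :
  inverse_of (1 - z *: c) y -> inverse_of (1 - z' *: c) y' ->
  normc (z - z') * (nrm y' * nrm c) <= 1 / 2 -> nrm y <= 2 * nrm y'.
Proof.
move=> zy zy' small; have E := resolvent_eq zy zy'.
have H1 : nrm y <= nrm y' + nrm (y - y').
  by rewrite -{1}(subrK y' y) addrC; exact: nrmD hA _ _.
have H2 : nrm (y - y') <= normc (z - z') * (nrm y' * nrm c) * nrm y.
  rewrite E (nrm_scale hA) -[leRHS]mulrA; apply: ler_wpM2l.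
    by rewrite /ComplexField.Normc.normc; case: (z - z') => ? ?; exact: sqrtr_ge0.
  apply: le_trans (nrmM hA _ _) _; apply: ler_wpM2r => //.
  exact: (nrmM hA).
have := ler_wpM2r (nrm_ge0' hA y) small; lra.
Qed.

(** Local boundedness is spread over the square by interval induction, first over the real part and,
    within a thin vertical strip, over the imaginary part. *)
Lemma resolvent_bounded (c : A) : (forall z : R[i], invertible (1 - z *: c)) ->
  exists M, forall x y w, -1 <= x <= 1 -> -1 <= y <= 1 ->
    inverse_of (1 - Complex x y *: c) w -> nrm w <= M.
Proof.
move=> inv.
pose bnd x1 x2 y1 y2 M := forall x y w, x1 <= x <= x2 -> y1 <= y <= y2 ->
    inverse_of (1 - Complex x y *: c) w -> nrm w <= M.
suff : exists M, bnd (-1) 1 (-1) 1 M by [].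
have m11 : (-1 : R) <= 1 by lra.
apply: (interval_induction (B := fun x1 x2 => exists M, bnd x1 x2 (-1) 1 M) m11).
  move=> x y z xy yz [M1 b1] [M2 b2]; exists (Num.max M1 M2) => x' y' w /andP[xx' x'z] yy' H.
  rewrite le_max; have [x'y|yx'] := leP x' y.
    by rewrite (b1 x' y') ?xx'.
  by rewrite (b2 x' y') ?orbT // x'z ltW.
move=> x.
suff [d [d0 [M bM]]] : exists d, 0 < d /\ exists M, bnd (x - d) (x + d) (-1) 1 M.
  exists d => // y z dy yz zd; exists M => x' y' w /andP[yx' x'z]; apply: bM.
  by rewrite (le_trans dy yx') (le_trans x'z zd).
apply: (interval_induction
  (B := fun y1 y2 => exists d, 0 < d /\ exists M, bnd (x - d) (x + d) y1 y2 M) m11).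
  move=> y1 y2 y3 y12 y23 [d1 [d10 [M1 b1]]] [d2 [d20 [M2 b2]]].
  exists (Num.min d1 d2); split; first by rewrite lt_min d10.
  have m1 : Num.min d1 d2 <= d1 by rewrite ge_min lexx.
  have m2 : Num.min d1 d2 <= d2 by rewrite ge_min lexx orbT.
  exists (Num.max M1 M2) => x' y' w /andP[xx' x'z] /andP[yy' y'z] H.
  rewrite le_max; have [yle|ygt] := leP y' y2.
    by rewrite (b1 x' y') //; apply/andP; split=> //; move: m1 xx' x'z; lra.
  rewrite (b2 x' y') ?orbT //; apply/andP; split=> //; first by move: m2 xx' x'z; lra.
    by move: m2 xx' x'z; lra.
  exact: ltW.
move=> y; have [w0 w0P] := inv (Complex x y).
(* A point of the box is within [2 d] of its centre, and [2 d] times [nrm w0 * nrm c] is at most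
   1/2. *)
pose d := (4 * (nrm w0 * nrm c + 1))^-1.
have K0 : 0 <= nrm w0 * nrm c by exact: mulr_ge0.
have d0 : 0 < d by rewrite invr_gt0; move: K0; lra.
exists d => // y1 y2 dy y12 yd; exists d; split=> //.
exists (2 * nrm w0) => x' y' w /andP[xx1 xx2] /andP[yy1 yy2] wP.
apply: (resolvent_locally_bounded wP w0P).
have n2 : normc (Complex x' y' - Complex x y) <= 2 * d.
  have -> : Complex x' y' - Complex x y = Complex (x' - x) (y' - y) :> R[i] by [].
  apply: le_trans (normc_re_im _ _) _.
  have : `|x' - x| <= d by rewrite ler_norml; apply/andP; split; move: xx1 xx2; lra.
  have : `|y' - y| <= d.
    by rewrite ler_norml; apply/andP; split; move: yy1 yy2 dy yd; lra.
  lra.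
apply: le_trans (ler_wpM2r K0 n2) _.
have : d * (4 * (nrm w0 * nrm c + 1)) = 1 by rewrite mulVf // gt_eqF //; move: K0; lra.
move: d0 K0; lra.
Qed.

Lemma normc_sqr (z : R[i]) : normc (z ^+ 2) = normc z ^+ 2.
Proof. by rewrite !expr2 ComplexField.Normc.normcM. Qed.

Lemma normc_ge0 (z : R[i]) : 0 <= normc z.
Proof. by case: z => x y; exact: sqrtr_ge0. Qed.

Lemma invertibleZ (z : R[i]) (x : A) : z != 0 -> invertible x -> invertible (z *: x).
Proof.
move=> z0 [y [xy yx]]; exists (z^-1 *: y); split.
  by rewrite -scalerAl -scalerAr xy scalerA mulfV // scale1r.
by rewrite -scalerAl -scalerAr yx scalerA mulVf // scale1r.
Qed.

Lemma one_sub_sqr (s : R[i]) (C : A) :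
  1 - (s ^+ 2) *: (C * C) = (1 - s *: C) * (1 - (- s) *: C).
Proof.
have -> : s ^+ 2 *: (C * C) = (s *: C) * (s *: C).
  by rewrite -scalerAl -scalerAr scalerA expr2.
by rewrite scaleNr; ncring.
Qed.

(* [1/(1-x^2)] is the mean of [1/(1-x)] and [1/(1+x)], so a modulus of continuity
   of the resolvent of [c] is inherited by the resolvents of all [c^(2^k)]. *)
Lemma resolvent_pow (c : A) (L r : R) :
  (forall z : R[i], invertible (1 - z *: c)) ->
  (forall (s : R[i]) h h', normc s <= 1 -> inverse_of (1 - s *: c) h ->
    inverse_of (1 - ((r%:C)%C * s) *: c) h' -> nrm (h - h') <= L) ->
  forall k, (forall z : R[i], invertible (1 - z *: c ^+ (2 ^ k))) /\
  (forall (s : R[i]) h h', normc s <= 1 -> inverse_of (1 - s *: c ^+ (2 ^ k)) h ->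
    inverse_of (1 - (((r ^+ (2 ^ k))%:C)%C * s) *: c ^+ (2 ^ k)) h' -> nrm (h - h') <= L).
Proof.
move=> inv cont; elim=> [|k [invk contk]]; first by rewrite expn0 !expr1.
have -> : c ^+ (2 ^ k.+1) = c ^+ (2 ^ k) * c ^+ (2 ^ k).
  by rewrite -exprD addnn -mul2n expnS.
have -> : r ^+ (2 ^ k.+1) = r ^+ (2 ^ k) ^+ 2 by rewrite -exprM expnSr.
set C := c ^+ _ in invk contk *; set q := r ^+ _ in contk *.
(* The factors [x] and [y] of [1 - s^2 C^2] commute and add up to 2, so
   [g + g' = h (x + y) = 2 h]. *)
have mean (s : R[i]) h g g' : inverse_of (1 - s ^+ 2 *: (C * C)) h ->
    inverse_of (1 - s *: C) g -> inverse_of (1 - (- s) *: C) g' -> h + h = g + g'.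
  rewrite one_sub_sqr => -[_ hE] [gE _] [g'E _].
  set x := 1 - s *: C in hE gE *; set y := 1 - (- s) *: C in hE g'E *.
  have xy : x * y = y * x by rewrite -one_sub_sqr -sqrrN one_sub_sqr opprK.
  have yx : y + x = 1 + 1 by rewrite /x /y scaleNr; ncring.
  rewrite -[g + g']mul1r -hE mulrDr {1}xy -!mulrA gE g'E mulr1.
  by rewrite -mulrDr mulr1 yx mulrDr mulr1.
split=> [z|s h h' s1 hE h'E].
  rewrite -(sqrtCK z) one_sub_sqr; apply: invertibleM; exact: invk.
set z := sqrtC s.
have z1 : normc z <= 1.
  have : normc z ^+ 2 <= 1 by rewrite -normc_sqr sqrtCK.
  by rewrite -[leRHS](expr1n _ 2) ler_sqr ?nnegrE ?normc_ge0.
have [g gP] := invk z; have [g' g'P] := invk (- z).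
have [f fP] := invk ((q%:C)%C * z); have [f' f'P] := invk ((q%:C)%C * (- z)).
have H1 : h + h = g + g' by apply: mean gP g'P; rewrite sqrtCK.
have H2 : h' + h' = f + f'.
  apply: (mean ((q%:C)%C * z)) => //; last by rewrite -mulrN.
  by rewrite exprMn sqrtCK -rmorphXn.
have d1 := contk _ _ _ z1 gP fP.
have d2 : nrm (g' - f') <= L by apply: contk g'P f'P; rewrite normcN.
have : nrm (real_scalar A 2 * (h - h')) <= L + L.
  have -> : real_scalar A 2 * (h - h') = (g - f) + (g' - f').
    transitivity ((h + h) - (h' + h')); last by rewrite H1 H2; ncring.
    by rewrite (_ : 2 = 1 + 1) // rscD rsc1; ncring.
  by apply: le_trans (nrmD hA _ _) _; exact: lerD.
by rewrite (nrm_rscM hA) ger0_norm ?ler0n //; lra.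
Qed.

(** An argument without complex analysis. For [r] slightly below 1 the resolvents at [s] and [r s]
    differ by at most 1/8 on the unit disc. The bound passes to [C = c^(2^N)], where [r] becomes a
    tiny [q]. The resolvent of [C] at [q] is close to 1, so the one at 1 is within 1/4 of 1. This
    gives [C] norm at most 1/2, but [C] has norm 1. *)
Lemma quasinilpotent_normed (c : A) : sa c -> nrm c = 1 ->
  (forall z : R[i], invertible (1 - z *: c)) -> False.
Proof.
move=> sc c1 inv; have [M0 M0P] := resolvent_bounded inv.
pose M := Num.max M0 1.
have M1 : 1 <= M by rewrite le_max lexx orbT.
have MP (z : R[i]) w : normc z <= 1 -> inverse_of (1 - z *: c) w -> nrm w <= M.
  case: z => x y z1 wP; rewrite le_max; apply/orP; left.
  have hx : `|x| <= 1 /\ `|y| <= 1.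
    have h2 : x ^+ 2 + y ^+ 2 <= 1.
      rewrite -(sqr_sqrtr (a := x ^+ 2 + y ^+ 2)) ?addr_ge0 ?sqr_ge0 //.
      by rewrite expr_le1 ?sqrtr_ge0.
    have := sqr_ge0 x; have := sqr_ge0 y => ? ?.
    by split; rewrite -[leRHS]/(1 : R) -(@expr_le1 _ 2) // -normrX ger0_norm; lra.
  by case: hx; rewrite !ler_norml => hx hy; exact: M0P hx hy wP.
pose L := M * M; have L1 : 1 <= L by rewrite /L; nra.
(* [L] bounds [h' c h] on the unit disc, so [(1 - r) L = 1/8] is the modulus of continuity
   wanted. *)
pose r := 1 - (8 * L)^-1.
have LV : L * (8 * L)^-1 = 1 / 8 by field; rewrite gt_eqF //; lra.
have V0 : 0 < (8 * L)^-1 by rewrite invr_gt0; lra.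
have V1 : (8 * L)^-1 <= 1 / 8 by move: LV L1 V0; nra.
have r0 : 0 <= r by rewrite /r; lra.
have r1 : r < 1 by rewrite /r; lra.
have cont (s : R[i]) h h' : normc s <= 1 -> inverse_of (1 - s *: c) h ->
    inverse_of (1 - ((r%:C)%C * s) *: c) h' -> nrm (h - h') <= 1 / 8.
  move=> s1 hP h'P; rewrite (resolvent_eq hP h'P) (nrm_scale hA).
  have hM := MP _ _ s1 hP.
  have h'M : nrm h' <= M.
    apply: MP h'P; rewrite ComplexField.Normc.normcM normc_real ger0_norm //.
    by have := normc_ge0 s; nra.
  have -> : normc (s - (r%:C)%C * s) = (8 * L)^-1 * normc s.
    have -> : s - (r%:C)%C * s = (((8 * L)^-1)%:C)%C * s.
      by rewrite -{1}[s]mul1r -mulrBl -(rmorph1 (real_complex R)) -rmorphB /r opprB addrC subrK.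
    by rewrite ComplexField.Normc.normcM normc_real ger0_norm // ltW.
  have n1 : nrm (h' * c * h) <= L.
    apply: le_trans (nrmM hA _ _) _; apply: ler_pM => //.
    by apply: le_trans (nrmM hA _ _) _; rewrite c1 mulr1.
  rewrite -LV [leRHS]mulrC; apply: ler_pM => //; first by rewrite mulr_ge0 ?normc_ge0 // ltW.
  by rewrite ler_piMr // ltW.
have [N HN] : exists N, forall n, (N <= n)%N -> r ^+ n < 1 / 9.
  by apply: expr_small => //; lra.
have [invk contk] := resolvent_pow inv cont N.
set C := c ^+ _ in invk contk; set q := r ^+ _ in contk.
have q9 : q < 1 / 9 by apply: HN; exact: ltnW (ltn_expl _ _).
have q0 : 0 <= q by exact: exprn_ge0.
have C1 : nrm C = 1 by rewrite /C (sa_nrmX hA) // c1 expr1n.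
have [h hP] := invk 1; have [h' h'P] := invk ((q%:C)%C * 1).
have n1 : normc (1 : R[i]) <= 1 by rewrite ComplexField.Normc.normc1.
have hh' := contk _ _ _ n1 hP h'P.
have qC : ((q%:C)%C * 1) *: C = real_scalar A q * C by rewrite mulr1 rscE.
have [h'E _] := h'P; rewrite qC in h'E.
have nqC : nrm (real_scalar A q * C) = q by rewrite (nrm_rscM hA) C1 mulr1 ger0_norm.
have h'98 : nrm h' <= 9 / 8.
  have := near_rsc_inverse hA 1 h'E.
  have -> : real_scalar A 1 - (1 - real_scalar A q * C) = real_scalar A q * C by rewrite rsc1; ncring.
  rewrite nqC; have := nrm_ge0' hA h'; nra.
have h'1 : nrm (h' - 1) <= 1 / 8.
  have -> : h' - 1 = real_scalar A q * C * h' by rewrite -h'E; ncring.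
  by apply: le_trans (nrmM hA _ _) _; rewrite nqC; have := nrm_ge0' hA h'; nra.
have h1 : nrm (h - 1) <= 1 / 4.
  by have := nrmBt hA h h' 1; move: hh' h'1; lra.
have [hE _] := hP; rewrite scale1r in hE.
have Ch : h - 1 = C * h by transitivity (h - (1 - C) * h); [rewrite hE|ncring].
have CE : C = (h - 1) - C * (h - 1) by transitivity (C * h - C * (h - 1)); [ncring|rewrite -Ch].
have := nrmB hA (h - 1) (C * (h - 1)); rewrite -CE C1.
by have := nrmM hA C (h - 1); rewrite C1; move: h1; lra.
Qed.

Lemma quasinilpotent_sa (c : A) : sa c ->
  (forall z : R[i], invertible (1 - z *: c)) -> c = 0.
Proof.
move=> sc inv; apply: contrapT => c0.
have n0 : 0 < nrm c.
  rewrite lt_def (nrm_ge0' hA) andbT; apply/eqP => n0; exact: c0 (nrm_eq0 hA n0).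
apply: (@quasinilpotent_normed (real_scalar A (nrm c)^-1 * c)).
- by rewrite /self_adjoint (star_rscM hA) sc.
- by rewrite (nrm_rscM hA) ger0_norm ?invr_ge0 ?ltW // mulVf // gt_eqF.
- by move=> z; rewrite -rscE scalerA; exact: inv.
Qed.

End QuasiNilpotent.

(** * Spectral projections *)

Section Spectral.
Variables (R : realType) (A : algType R[i]) (star : A -> A) (nrm : A -> R).
Hypothesis hA : is_unital_cstar star nrm.
Local Notation sa := (self_adjoint star).

Definition proj_family n (p : 'I_n -> A) :=
  [/\ forall i, sa (p i), forall i j, p i * p j = if i == j then p i else 0
    & \sum_i p i = 1].

Definition diag n (p : 'I_n -> A) (l : 'I_n -> R) := \sum_i real_scalar A (l i) * p i.

Lemma horner_alg_eigen (b p : A) (l : R[i]) (q : {poly R[i]}) : b * p = l *: p ->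
  horner_alg b q * p = q.[l] *: p.
Proof.
move=> bp; elim/poly_ind: q => [|q c IHq]; first by rewrite rmorph0 mul0r horner0 scale0r.
rewrite rmorphD rmorphM /= horner_algX horner_algC mulrDl -mulrA bp -scalerAr IHq.
by rewrite -scalerAl mul1r scalerA -scalerDl hornerMXaddC mulrC.
Qed.

Lemma invertible_prod_XsubC (b : A) (r : seq R[i]) :
  (forall m, m \in r -> invertible (b - m%:A)) ->
  invertible (horner_alg b (\prod_(m <- r) ('X - m%:P))).
Proof.
elim: r => [|m r IHr] inv; first by rewrite big_nil rmorph1; exists 1; rewrite mulr1.
rewrite big_cons rmorphM rmorphB /= horner_algX horner_algC; apply: invertibleM.
  by apply: inv; rewrite inE eqxx.
by apply: IHr => z zr; apply: inv; rewrite inE zr orbT.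
Qed.

Lemma star_horner_prod (b : A) (r : seq R[i]) : sa b ->
  star (horner_alg b (\prod_(m <- r) ('X - m%:P))) =
  horner_alg b (\prod_(m <- r) ('X - (conjc m)%:P)).
Proof.
move=> sb; elim: r => [|m r IHr]; first by rewrite !big_nil !rmorph1 (star1 hA).
rewrite !big_cons [in LHS]rmorphM (star_mul hA) IHr mulrC rmorphM.
congr (_ * _); rewrite !rmorphB /= !horner_algX !horner_algC (starB hA) sb.
by rewrite (star_scale hA) (star1 hA).
Qed.

(** Let [g] have simple roots at the spectrum and its conjugates. Then [g(b)] is self-adjoint, and
    for [z <> 0] no root of [g - 1/z] lies in the spectrum, so [1 - z g(b)] is a product of
    invertible factors. Hence [g(b)] is quasinilpotent and vanishes. *)
Lemma annihilating_poly (b : A) : sa b -> finite_spectrum b ->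
  exists2 s : seq R[i], uniq s & horner_alg b (\prod_(m <- s) ('X - m%:P)) = 0.
Proof.
(* The added 0 makes [g] nonconstant, so that subtracting [1/z] leaves its leading coefficient 1. *)
move=> sb [s0 s0P]; pose s := undup (0 :: s0 ++ map conjc s0).
have us : uniq s by exact: undup_uniq.
have cK : cancel (fun z : R[i] => conjc z) (fun z : R[i] => conjc z).
  by move=> [x y] /=; rewrite opprK.
have cI : injective (fun z : R[i] => conjc z) := can_inj cK.
exists s => //; set g := \prod_(m <- s) _.
apply: (quasinilpotent_sa hA).
  rewrite /self_adjoint star_horner_prod //.
  rewrite -(big_map (fun z : R[i] => conjc z) xpredT (fun m => 'X - m%:P)).
  apply: (congr1 (horner_alg b)); apply: perm_big; apply: uniq_perm => //.
    by rewrite map_inj_uniq.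
  have c0 : 0 = conjc 0 :> R[i] by rewrite conjc0.
  move=> x; have -> : (x \in map (fun z : R[i] => conjc z) s) = (conjc x \in s).
    by have := mem_map cI s (conjc x); rewrite cK.
  rewrite !mem_undup !inE !mem_cat {1}c0 (inj_eq cI); congr (_ || _).
  have mE y : (y \in map conjc s0) = (conjc y \in s0) by have := mem_map cI s0 (conjc y); rewrite cK.
  by rewrite !mE cK orbC.
move=> z; have [->|z0] := eqVneq z 0.
  by rewrite scale0r subr0; exists 1; rewrite mulr1.
have szg : (1 < size g)%N.
  rewrite size_prod_XsubC ltnS -has_predT; apply/hasP; exists 0 => //.
  by rewrite mem_undup inE eqxx.
have [r rE] := closed_field_poly_normal (g - (z^-1)%:P).
have lg : lead_coef (g - (z^-1)%:P) = 1.
  rewrite lead_coefDl ?size_polyN ?(leq_ltn_trans (size_polyC_leq1 _)) //.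
  exact/monicP/monic_prod_XsubC.
rewrite lg scale1r in rE.
have -> : 1 - z *: horner_alg b g = (- z) *: horner_alg b (g - (z^-1)%:P).
  by rewrite rmorphB /= horner_algC scalerBr scalerA mulNr mulfV // scaleNr scaleN1r opprK addrC.
apply: invertibleZ; first by rewrite oppr_eq0.
rewrite rE; apply: invertible_prod_XsubC => m mr; apply: contrapT => /s0P ms.
have : root (g - (z^-1)%:P) m by rewrite rE root_prod_XsubC.
rewrite rootE hornerD hornerN hornerC.
have /rootP -> : root g m by rewrite root_prod_XsubC mem_undup inE mem_cat ms orbT.
by rewrite sub0r oppr_eq0 invr_eq0 (negbTE z0).
Qed.

(** The projections are the Lagrange polynomials at the roots, evaluated at [b]. Those at nonreal
    roots vanish, and the others are self-adjoint since eigenspaces of [b] for distinct real values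
    are orthogonal. *)
Lemma spectral_decomposition (b : A) : sa b -> finite_spectrum b ->
  exists n (p : 'I_n -> A) (l : 'I_n -> R), proj_family p /\ b = diag p l.
Proof.
move=> sb fb; have [s us gb] := annihilating_poly sb fb.
set n := size s; pose la (i : 'I_n) := s`_i.
have la_inj : injective la.
  by move=> i j /eqP; rewrite nth_uniq // => /eqP/val_inj.
pose u i : {poly R[i]} := \prod_(j : 'I_n | j != i) ('X - (la j)%:P).
have gE i : \prod_(m <- s) ('X - m%:P) = ('X - (la i)%:P) * u i.
  by rewrite (big_nth 0) big_mkord (bigD1 i).
have ui i : (u i).[la i] != 0.
  rewrite horner_prod; apply/prodf_neq0 => j ji.
  by rewrite hornerXsubC subr_eq0 (inj_eq la_inj) eq_sym.
have uj i j : j != i -> (u i).[la j] = 0.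
  move=> ji; rewrite horner_prod (bigD1 j) //= hornerXsubC subrr.
  by rewrite mul0r.
pose L i := (u i).[la i]^-1 *: u i.
have LE i j : (L i).[la j] = (i == j)%:R.
  rewrite hornerZ eq_sym; case: eqP => [->|/eqP ji]; first by rewrite mulVf.
  by rewrite (uj i j ji) mulr0.
(* The difference has size at most [n] and vanishes at [n] distinct points. *)
have sumL : \sum_i L i = 1.
  apply/eqP; rewrite -subr_eq0; apply/eqP.
  apply: (@roots_geq_poly_eq0 _ _ s) => //.
    apply/(all_nthP 0) => j js; rewrite rootE hornerD hornerN hornerC horner_sum.
    rewrite (bigD1 (Ordinal js)) //= (LE _ (Ordinal js)) eqxx big1 ?addr0 ?subrr //.
    by move=> i ij; rewrite (LE _ (Ordinal js)) (negbTE ij).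
  have n0 : (0 < n)%N.
    rewrite lt0n; apply/negP => /eqP/size0nil sE; move/eqP: gb.
    by rewrite sE big_nil rmorph1 oner_eq0.
  have su i : (size (u i) <= n)%N.
    have : size (\prod_(m <- s) ('X - m%:P)) = n.+1 by exact: size_prod_XsubC.
    rewrite (gE i) size_monicM ?monicXsubC ?size_XsubC //; first by case=> <-.
    by apply: contraNneq (ui i) => ->; rewrite horner0.
  apply: leq_trans (size_polyD _ _) _; rewrite geq_max size_polyN size_poly1 n0 andbT.
  apply: leq_trans (size_sum _ _ _) _; apply/bigmax_leqP => i _.
  exact: leq_trans (size_scale_leq _ _) (su i).
pose P i := horner_alg b (L i).
have bP i : b * P i = la i *: P i.
  apply/eqP; rewrite -subr_eq0; apply/eqP.
  transitivity ((u i).[la i]^-1 *: horner_alg b (\prod_(m <- s) ('X - m%:P))).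
    rewrite (gE i) rmorphM rmorphB /= horner_algX horner_algC /P /L linearZ /=.
    by rewrite mulrBl scalerBr -!scalerAl mul1r -!scalerAr !scalerA mulrC.
  by rewrite gb scaler0.
have PP i j : P i * P j = if i == j then P i else 0.
  rewrite [P i in LHS]/P (horner_alg_eigen _ (bP j)) LE.
  by case: eqP => [->|_]; rewrite ?scale1r ?scale0r.
have P1 : \sum_i P i = 1 by rewrite -(rmorph_sum (horner_alg b)) sumL rmorph1.
have sPb i : star (P i) * b = conjc (la i) *: star (P i).
  by rewrite -(star_scale hA) -bP (star_mul hA) sb.
have sPP i j : conjc (la i) != la j -> star (P i) * P j = 0.
  move=> ij; have : conjc (la i) *: (star (P i) * P j) = la j *: (star (P i) * P j).
    by rewrite scalerAl -sPb -mulrA bP -scalerAr.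
  move/eqP; rewrite -subr_eq0 -scalerBl => /eqP E.
  rewrite -[LHS](scalerK (a := conjc (la i) - la j)) ?subr_eq0 // E.
  by rewrite scaler0.
have nonreal i : conjc (la i) != la i -> P i = 0.
  move=> /sPP H; apply: (nrm_eq0 hA); apply/eqP.
  by rewrite -sqrf_eq0 -(cstar_identity hA) H (nrm0 hA).
have saP i : sa (P i).
  have [r|/nonreal ->] := eqVneq (conjc (la i)) (la i); last exact: star0 hA.
  have E : star (P i) = star (P i) * P i.
    rewrite -[LHS]mulr1 -P1 mulr_sumr (bigD1 i) //= big1 ?addr0 // => j ji.
    by apply: sPP; rewrite r (inj_eq la_inj) eq_sym.
  by have := congr1 star E; rewrite (star_mul hA) !(star_invol hA) -E.
exists n, P, (fun i => complex.Re (la i)); split; first by split.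
rewrite -[LHS]mulr1 -P1 mulr_sumr; apply: eq_bigr => i _; rewrite bP -rscE.
have [r|/nonreal ->] := eqVneq (conjc (la i)) (la i); last by rewrite !scaler0.
congr (_ *: _); move: r; case: (la i) => x y /= [] /eqP.
by rewrite eq_sym -addr_eq0 -mulr2n mulrn_eq0 /= => /eqP ->.
Qed.

End Spectral.

(** * Positivity and the exchange property *)

Section Positivity.
Variables (R : realType) (A : algType R[i]) (star : A -> A) (nrm : A -> R).
Hypothesis hA : is_unital_cstar star nrm.
Local Notation sa := (self_adjoint star).
Local Notation rsc := (real_scalar A).

Let nrm_nonneg x : 0 <= nrm x. Proof. exact: nrm_ge0' hA x. Qed.
Local Hint Resolve nrm_nonneg : core.

Lemma projection_norm_le1 (p : A) : sa p -> idem p -> nrm p <= 1.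
Proof.
move=> sp pp; have := cstar_identity hA p; rewrite sp pp => E.
rewrite leNgt; apply/negP => p1; have : nrm p < nrm p ^+ 2 by rewrite expr2 ltr_pMr // (lt_trans ltr01).
by rewrite -E ltxx.
Qed.

Lemma projection_norm_lt1 (p : A) : sa p -> idem p -> nrm p < 1 -> p = 0.
Proof.
move=> sp pp p1; have := cstar_identity hA p; rewrite sp pp => E.
apply: (nrm_eq0 hA); apply/eqP; rewrite eq_le nrm_nonneg andbT leNgt.
apply/negP => p0; have : nrm p * nrm p < nrm p by rewrite gtr_pMr.
by rewrite -expr2 -E ltxx.
Qed.

Section Diag.
Variables (n : nat) (p : 'I_n -> A).
Hypothesis hp : proj_family star p.
Implicit Types l : 'I_n -> R.

Lemma diag_mulr l i : diag p l * p i = rsc (l i) * p i.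
Proof.
have [_ op _] := hp; rewrite mulr_suml (bigD1 i) //= -mulrA op eqxx big1 ?addr0 // => j ji.
by rewrite -mulrA op (negbTE ji) mulr0.
Qed.

Lemma diagM l l' : diag p l * diag p l' = diag p (fun i => l i * l' i).
Proof.
rewrite [diag p l' in LHS]/diag mulr_sumr; apply: eq_bigr => i _.
by rewrite mulrA rscC -mulrA diag_mulr mulrA -rscM mulrC.
Qed.

Lemma diagD l l' : diag p l + diag p l' = diag p (fun i => l i + l' i).
Proof. by rewrite -big_split; apply: eq_bigr => i _; rewrite rscD mulrDl. Qed.

Lemma diagN l : - diag p l = diag p (fun i => - l i).
Proof. by rewrite -sumrN; apply: eq_bigr => i _; rewrite rscN mulNr. Qed.

Lemma diagB l l' : diag p l - diag p l' = diag p (fun i => l i - l' i).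
Proof. by rewrite diagN diagD. Qed.

Lemma diag_const t : diag p (fun=> t) = rsc t.
Proof. by have [_ _ p1] := hp; rewrite /diag -mulr_sumr p1 mulr1. Qed.

Lemma sa_diag l : sa (diag p l).
Proof.
have [sp _ _] := hp; rewrite /self_adjoint (star_sum hA).
by apply: eq_bigr => i _; rewrite (star_rscM hA) sp.
Qed.

Lemma diagX l k : diag p l ^+ k = diag p (fun i => l i ^+ k).
Proof.
elim: k => [|k IHk]; first by rewrite expr0 diag_const rsc1.
by rewrite exprS IHk diagM; apply: eq_bigr => i _; rewrite exprS.
Qed.

(** The triangle inequality loses a factor [n]; applied to the powers [2^k], whose norms are powers
    of the norm, it loses nothing in the limit. *)
Lemma diag_norm l M : 0 <= M -> (forall i, `|l i| <= M) -> nrm (diag p l) <= M.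
Proof.
move=> M0 lM; have [sp op _] := hp.
have bound k : nrm (diag p l) ^+ (2 ^ k) <= n%:R * M ^+ (2 ^ k).
  rewrite -(sa_nrmX hA k (sa_diag l)) diagX.
  apply: le_trans (nrm_sum hA _ _ _) _.
  rewrite mulr_natl -[X in _ *+ X]card_ord -sumr_const; apply: ler_sum => i _.
  rewrite (nrm_rscM hA) normrX.
  have pi1 : nrm (p i) <= 1 by apply: projection_norm_le1 => //; rewrite /idem op eqxx.
  have lk : `|l i| ^+ (2 ^ k) <= M ^+ (2 ^ k) by rewrite lerXn2r ?nnegrE.
  by rewrite -[leRHS]mulr1; apply: ler_pM; rewrite ?exprn_ge0.
rewrite le0r in M0; case/orP: M0 => [/eqP M0|M0].
  by have := bound 0%N; rewrite !expr1 M0 mulr0.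
rewrite -[leRHS]mul1r -ler_pdivrMr //; apply: (@expr_bounded_le1 _ _ n%:R).
  by rewrite divr_ge0 // ltW.
move=> k; exists (2 ^ k)%N; first exact: ltnW (ltn_expl _ _).
by rewrite expr_div_n ler_pdivrMr ?exprn_gt0.
Qed.

End Diag.

(** * Approximate positivity *)

(** A norm criterion for positivity: a self-adjoint element has spectrum in [[0, oo[] when it lies
    within [t] of some scalar [t]. The slack [e] makes sums and limits immediate. *)
Definition apos (a : A) :=
  forall e, 0 < e -> exists2 t, 0 <= t & nrm (rsc t - a) <= t + e.

Lemma aposD a b : apos a -> apos b -> apos (a + b).
Proof.
move=> pa pb e e0; have e2 : 0 < e / 2 by rewrite divr_gt0.
have [t t0 ta] := pa _ e2; have [s s0 sb] := pb _ e2.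
exists (t + s); first exact: addr_ge0.
have -> : rsc (t + s) - (a + b) = (rsc t - a) + (rsc s - b) by rewrite rscD; ncring.
by have := nrmD hA (rsc t - a) (rsc s - b); move: ta sb; lra.
Qed.

Lemma apos_scale r a : 0 < r -> apos a -> apos (rsc r * a).
Proof.
move=> r0 pa e e0; have [|t t0 ta] := pa (e / r); first exact: divr_gt0.
exists (r * t); first by rewrite mulr_ge0 // ltW.
rewrite rscM -mulrBr (nrm_rscM hA) gtr0_norm //.
apply: le_trans (ler_wpM2l (ltW r0) ta) _.
by rewrite mulrDr mulrCA mulfV ?mulr1 // gt_eqF.
Qed.

Lemma apos_close a : (forall e, 0 < e -> exists2 b, apos b & nrm (a - b) <= e) -> apos a.
Proof.
move=> ab e e0; have e2 : 0 < e / 2 by rewrite divr_gt0.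
have [b pb abe] := ab _ e2; have [t t0 tb] := pb _ e2; exists t => //.
by have := nrmBt hA (rsc t) b a; rewrite [nrm (b - a)](nrmBC hA); move: abe tb; lra.
Qed.

Lemma apos_diag n (p : 'I_n -> A) l : proj_family star p ->
  (forall i, 0 <= l i) -> apos (diag p l).
Proof.
move=> hp l0 e e0; have T0 : 0 <= \sum_i l i by apply: sumr_ge0.
exists (\sum_i l i) => //; apply: (@le_trans _ _ (\sum_i l i)); last by rewrite lerDl ltW.
rewrite -(diag_const hp) (diagB p); apply: (diag_norm hp) => // i.
have lT : l i <= \sum_i l i by rewrite (bigD1 i) //= lerDl sumr_ge0.
by rewrite ger0_norm ?subr_ge0 // gerBl.
Qed.

Hypothesis rr0 : real_rank_zero star nrm.

Lemma diag_approx a e : sa a -> 0 < e ->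
  exists n (p : 'I_n -> A) l, proj_family star p /\ nrm (a - diag p l) < e.
Proof.
move=> sa_a e0; have [b [sb fb ab]] := rr0 sa_a e0.
have [n [p [l [hp bE]]]] := spectral_decomposition hA sb fb.
by exists n, p, l; rewrite -bE.
Qed.

Lemma apos_sqr u : sa u -> apos (u * u).
Proof.
move=> su; apply: apos_close => e e0.
have D0 : 0 < 2 * nrm u + 1 + e by have := nrm_nonneg u; move: e0; lra.
(* Then [d <= 1] and [d (2 nrm u + d) <= e], which bounds the change of the square. *)
pose d := e / (2 * nrm u + 1 + e); have d0 : 0 < d by exact: divr_gt0.
have dD : d * (2 * nrm u + 1 + e) = e by rewrite mulfVK // gt_eqF.
have [n [p [l [hp ul]]]] := diag_approx su d0.
exists (diag p l * diag p l).
  by rewrite (diagM hp); apply: apos_diag => // i; rewrite -expr2 sqr_ge0.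
set v := diag p l in ul *.
have -> : u * u - v * v = u * (u - v) + (u - v) * v by ncring.
have h1 := nrmD hA (u * (u - v)) ((u - v) * v).
have h2 := nrmM hA u (u - v); have h3 := nrmM hA (u - v) v.
have h4 : nrm v <= nrm u + nrm (u - v).
  by rewrite [nrm (u - v)](nrmBC hA) -{1}(subrK u v) addrC; exact: (nrmD hA).
have := nrm_nonneg u; have := nrm_nonneg v; have := nrm_nonneg (u - v).
move: (nrm u) (nrm v) (nrm (u - v)) (nrm (u * (u - v) + _)) (nrm (u * _)) (nrm (_ * v))
  h1 h2 h3 h4 ul D0 dD => a b c x y z h1 h2 h3 h4 cd D0 dD c0 b0 a0.
have d1 : d <= 1 by nra.
nra.
Qed.

(** The sum is [(u^2 + v^2) / 2], with [u] and [v] twice the real part and, up to sign, twice the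
    imaginary part of [y]. *)
Lemma apos_star_sum y : apos (y * star y + star y * y).
Proof.
pose u := y + star y; pose v := 'i%C *: (y - star y).
have su : sa u by rewrite /self_adjoint (star_add hA) (star_invol hA) addrC.
have sv : sa v.
  rewrite /self_adjoint (star_scale hA) (starB hA) (star_invol hA) -opprB scalerN -scaleNr.
  by congr (_ *: _); apply/eqP; rewrite eq_complex /= !oppr0 opprK !eqxx.
have vv : v * v = - ((y - star y) * (y - star y)).
  by rewrite -scalerAl -scalerAr scalerA -expr2 sqr_i scaleN1r.
have -> : y * star y + star y * y = rsc (1 / 2) * (u * u + v * v).
  have -> : u * u + v * v = rsc 2 * (y * star y + star y * y).
    by rewrite vv /u (_ : 2 = 1 + 1) // rscD rsc1; ncring.
  by rewrite mulrA -rscM mulfVK ?pnatr_eq0 // rsc1 mul1r.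
by apply: apos_scale; [lra|apply: aposD; exact: apos_sqr].
Qed.

(* Kaplansky's argument: on a spectral projection where [z z*] is negative,
   [y = p z] has both [- y y*] and [y y* + y* y] positive, hence so is [y* y],
   and [y (y* y + s) = (y y* + s) y] is small; this forces [y = 0]. *)
Lemma negative_part_mul_star z n (p : 'I_n -> A) l e i : proj_family star p ->
  nrm (z * star z - diag p l) < e -> l i < - (4 * e) -> p i = 0.
Proof.
move=> hp; set d := diag p l => zd li; have [sp op _] := hp.
have e0 : 0 < e by exact: le_lt_trans zd.
pose s := - l i; have s4e : 4 * e < s by rewrite /s; lra.
set q := p i; have qq : q * q = q by rewrite op eqxx.
have q1 : nrm q <= 1 by exact: projection_norm_le1 (sp i) qq.
pose y := q * z; have qy : q * y = y by rewrite /y mulrA qq.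
have sy : star y = star z * q by rewrite (star_mul hA) sp.
have dq : d * q = - (rsc s * q).
  by rewrite (diag_mulr hp) /s rscN mulNr opprK.
pose E := y * star y + rsc s * q.
have EE : E = q * (z * star z - d) * q.
  have -> : q * (z * star z - d) * q = (q * z) * (star z * q) - q * (d * q) by ncring.
  by rewrite (_ : q * (d * q) = - (rsc s * q)) ?opprK ?/E ?sy // dq mulrN mulrA rscC -mulrA qq.
have nE : nrm E <= e.
  rewrite EE; apply: le_trans (nrmM hA _ _) _.
  have := nrmM hA q (z * star z - d); have := nrm_nonneg q.
  have := nrm_nonneg (z * star z - d); have := nrm_nonneg (q * (z * star z - d)).
  nra.
have [t t0 tX] : exists2 t, 0 <= t &
    nrm (rsc t - (y * star y + star y * y + rsc s * q)) <= t + s / 4.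
  have s0 : 0 < s by lra.
  suff : apos (y * star y + star y * y + rsc s * q) by apply; lra.
  apply: aposD; first exact: apos_star_sum.
  by apply: apos_scale => //; rewrite -qq; apply: apos_sqr; exact: sp.
(* [w] differs by the small [E] from an element that is positive up to [s / 4], plus the scalar [s];
   so its inverse [g] has norm at most [2 / s]. *)
pose w := star y * y + rsc s.
have nw : nrm (rsc (t + s) - w) <= t + s / 2.
  have -> : rsc (t + s) - w = (rsc t - (y * star y + star y * y + rsc s * q)) + E.
    by rewrite /w /E rscD; ncring.
  by apply: le_trans (nrmD hA _ _) _; move: tX nE s4e e0; lra.
have [g [wg _]] : invertible w.
  by apply: (near_rsc_invertible hA (r := t + s)); move: nw s4e e0; lra.
have ng : s / 2 * nrm g <= 1.
  have := near_rsc_inverse hA (t + s) wg; apply: le_trans.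
  by apply: ler_wpM2r => //; move: nw; lra.
have yw : y * w = E * y.
  transitivity (y * star y * y + y * rsc s); first by rewrite /w; ncring.
  by rewrite rscC -[X in rsc s * X]qy /E; ncring.
(* As [nrm E * nrm g <= 2 e / s <= 1/2], this forces [y = 0]; then [E = s q] is smaller than [s],
   and the projection [q] vanishes. *)
have yE : y = E * y * g by rewrite -yw -mulrA wg mulr1.
have y0 : y = 0.
  apply: (nrm_eq0 hA); apply/eqP; rewrite eq_le nrm_nonneg andbT.
  have h1 := nrmM hA (E * y) g; have h2 := nrmM hA E y; rewrite -yE in h1.
  have := nrm_nonneg y; have := nrm_nonneg g; have := nrm_nonneg E.
  move: (nrm E) (nrm y) (nrm g) (nrm (E * y)) h1 h2 ng nE => a b c f h1 h2 h3 h4 a0 c0 b0.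
  have ac : a * c <= 1 / 2 by nra.
  have : b <= a * b * c by apply: le_trans h1 _; exact: ler_wpM2r.
  nra.
apply: (projection_norm_lt1 (sp i) qq).
have : nrm E <= e by [].
rewrite /E y0 mul0r add0r (nrm_rscM hA) gtr0_norm; last by lra.
by have := nrm_nonneg q; nra.
Qed.

(** Projections with coefficient below [- e / 2] vanish, so replacing negative coefficients by 0
    costs at most [e / 2]. *)
Lemma apos_mul_star z : apos (z * star z).
Proof.
apply: apos_close => e e0.
have szz : sa (z * star z) by rewrite /self_adjoint (star_mul hA) (star_invol hA).
have [|n [p [l [hp zl]]]] := @diag_approx _ (e / 8) szz; first by rewrite divr_gt0.
exists (diag p (fun i => Num.max 0 (l i))).
  by apply: apos_diag => // i; rewrite le_max lexx.
apply: le_trans (nrmBt hA _ (diag p l) _) _; rewrite (diagB p).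
have -> : diag p (fun i => l i - Num.max 0 (l i)) =
          diag p (fun i => if l i < - (4 * (e / 8)) then 0 else l i - Num.max 0 (l i)).
  apply: eq_bigr => i _; case: ifP => // li.
  by rewrite (negative_part_mul_star hp zl li) !mulr0.
have : nrm (diag p (fun i => if l i < - (4 * (e / 8)) then 0 else l i - Num.max 0 (l i)))
       <= e / 2.
  apply: diag_norm => // [|i]; first by lra.
  case: ltP => [_|li]; first by rewrite normr0; lra.
  by have [l0|l0] := leP 0 (l i); rewrite ?subrr ?normr0 ?subr0 ?ltr0_norm //; lra.
move: zl; lra.
Qed.

Lemma cstar_exchange : exchange A.
Proof.
move=> a; pose b := 1 - a; pose k := a * star a - b * star b.
have sk : sa k.
  by rewrite /self_adjoint (starB hA) !(star_mul hA) !(star_invol hA).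
have [|n [p [l [hp kl]]]] := @diag_approx k (1 / 8) sk; first by lra.
set k' := diag p l in kl; pose chi i : R := if 0 <= l i then 1 else 0.
pose P := diag p chi; pose z := a - b.
have PP : P * P = P.
  by rewrite (diagM hp); apply: eq_bigr => i _; rewrite /chi; case: ifP; rewrite ?mulr1 ?mulr0.
have sE : rsc 2 * P - 1 = diag p (fun i => if 0 <= l i then 1 else -1).
  rewrite -rsc1 -!(diag_const hp) (diagM hp) (diagB p).
  by apply: eq_bigr => i _; rewrite /chi; case: ifP => _; congr (rsc _ * _); lra.
have ks : k' * (rsc 2 * P - 1) = diag p (fun i => `|l i|).
  rewrite sE (diagM hp); apply: eq_bigr => i _; congr (rsc _ * _).
  by case: leP => l0; rewrite ?mulr1 ?mulrN1 ?(ger0_norm l0) ?(ltr0_norm l0).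
have ns : nrm (rsc 2 * P - 1) <= 1.
  by rewrite sE; apply: diag_norm => // i; case: ifP; rewrite ?normrN normr1.
pose w := a * star a * P + b * star b * (1 - P).
have two : rsc 2 = 1 + 1 by rewrite (_ : 2 = 1 + 1) // rscD rsc1.
have [t t0 tX] : exists2 t, 0 <= t &
    nrm (rsc t - (z * star z + rsc 2 * diag p (fun i => `|l i|))) <= t + 1 / 4.
  suff : apos (z * star z + rsc 2 * diag p (fun i => `|l i|)) by apply; lra.
  apply: aposD; first exact: apos_mul_star.
  by apply: apos_scale; [lra|apply: apos_diag].
(* As [a + b = 1], twice [a star a + b star b] is [1 + z star z]; and [w] is half of
   [a star a + b star b] plus half of [k (2 P - 1)]. Replacing [k] by [k'] turns the last product
   into [|k'|]. *)
have wE : rsc 4 * w = 1 + (z * star z + rsc 2 * diag p (fun i => `|l i|)) +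
    rsc 2 * ((k - k') * (rsc 2 * P - 1)).
  rewrite -ks (_ : 4 = 2 + 2); last by ring.
  rewrite rscD two /w /k /z /b !(starB hA) (star1 hA).
  clearbody P k'; clear; move: (star a) => a'; ncring.
have : invertible (rsc 4 * w).
  apply: (near_rsc_invertible hA (r := t + 1)).
  have -> : rsc (t + 1) - rsc 4 * w = (rsc t - (z * star z + rsc 2 * diag p (fun i => `|l i|)))
      - rsc 2 * ((k - k') * (rsc 2 * P - 1)).
    by rewrite wE rscD rsc1; ncring.
  apply: le_lt_trans (nrmB hA _ _) _; rewrite (nrm_rscM hA) ger0_norm //.
  have := nrmM hA (k - k') (rsc 2 * P - 1); have := nrm_nonneg (k - k').
  have := nrm_nonneg (rsc 2 * P - 1); move: ns kl tX; nra.
move=> [g0 [wg0 gw0]]; pose g := g0 * rsc 4.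
have wg : w * g = 1 by rewrite /g mulrA rscC mulrA.
have gw : g * w = 1 by rewrite /g -mulrA.
have wP : w * P = a * star a * P.
  transitivity (a * star a * (P * P) + b * star b * (P - P * P)); first by rewrite /w; ncring.
  by rewrite PP subrr mulr0 addr0.
exists (w * P * g), (star a * P * g), (star b * (1 - P) * g); split.
- rewrite /idem; transitivity (w * P * (g * w) * P * g); first by ncring.
  by rewrite gw mulr1 -(mulrA w) PP.
- by rewrite wP !mulrA.
- transitivity ((w - w * P) * g); first by rewrite mulrBl wg.
  by rewrite wP /w -/b; ncring.
Qed.

End Positivity.

(** * Characters from maximal ideals *)

Section Character.
Variables (R : realType) (A : algType R[i]) (star : A -> A) (nrm : A -> R).
Hypothesis hA : is_unital_cstar star nrm.
Hypothesis rr0 : real_rank_zero star nrm.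
Local Notation sa := (self_adjoint star).
Local Notation rsc := (real_scalar A).

Let nrm_nonneg x : 0 <= nrm x. Proof. exact: nrm_ge0' hA x. Qed.
Local Hint Resolve nrm_nonneg : core.

Definition proper_ideal (M : set A) := [/\ M 0, forall x y, M x -> M y -> M (x + y),
  forall a x c, M x -> M (a * x * c) & ~ M 1].

Lemma maximal_ideal (S : A -> Prop) : ~ ideal S 1 -> exists M : set A,
  [/\ proper_ideal M, forall x, ideal S x -> M x &
      forall N : set A, proper_ideal N -> (forall x, M x -> N x) -> forall x, N x -> M x].
Proof.
(* Zorn is applied to the sets whose union with the ideal of [S] is a proper ideal, so that the
   empty chain also has an upper bound. *)
move=> S1; pose U (X : set A) : set A := fun x => X x \/ ideal S x.
have [|X [PX maxX]] := @Zorn_bigcup A (fun X => proper_ideal (U X)).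
  move=> F FP Ftot; split.
  - by right; exact: ideal0.
  - move=> x y [[X FX Xx]|Ix] [[Y FY Yy]|Iy].
    + have [XY|YX] := Ftot _ _ FX FY.
      * have [_ UD _ _] := FP _ FY; have [||Z|Z] := UD x y; [left|left| |]; rewrite //.
        - exact: XY.
        - by left; exists Y.
        - by right.
      * have [_ UD _ _] := FP _ FX; have [||Z|Z] := UD x y; [left|left| |]; rewrite //.
        - exact: YX.
        - by left; exists X.
        - by right.
    + have [_ UD _ _] := FP _ FX; have [||Z|Z] := UD x y; [left|right| |]; rewrite //.
      - by left; exists X.
      - by right.
    + have [_ UD _ _] := FP _ FY; have [||Z|Z] := UD x y; [right|left| |]; rewrite //.
      - by left; exists Y.
      - by right.
    + by right; exact: idealD.
  - move=> a x c [[X FX Xx]|Ix]; last by right; exact: ideal_closed.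
    have [_ _ UM _] := FP _ FX; have [|Z|Z] := UM a x c; [by left| |by right].
    by left; exists X.
  - move=> [[X FX X1]|//]; have [_ _ _ U1] := FP _ FX; by apply: U1; left.
exists (U X); split=> // [x Ix|N PN XN x Nx]; first by right.
apply: contrapT => Ux; apply: (maxX N).
  split; first by move=> y Xy; apply: XN; left.
  by move=> NX; apply: Ux; left; exact: NX.
suff -> : U N = N by [].
apply/seteqP; split=> y; last by left.
by case=> // Iy; apply: XN; right.
Qed.

Variable M : set A.
Hypothesis PM : proper_ideal M.
Hypothesis IM : forall x, ideal (@halvable A) x -> M x.
Hypothesis maxM : forall N : set A, proper_ideal N -> (forall x, M x -> N x) ->
  forall x, N x -> M x.

Lemma mideal0 : M 0. Proof. by case: PM. Qed.
Lemma midealD x y : M x -> M y -> M (x + y). Proof. by case: PM => _ + _ _; exact. Qed.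
Lemma midealM a x c : M x -> M (a * x * c). Proof. by case: PM => _ _ + _; exact. Qed.
Lemma mideal1 : ~ M 1. Proof. by case: PM. Qed.
Lemma midealMl a x : M x -> M (a * x).
Proof. by move=> Mx; rewrite -[_ * _]mulr1; exact: midealM. Qed.
Lemma midealMr a x : M x -> M (x * a).
Proof. by move=> Mx; rewrite -[x]mul1r; exact: midealM. Qed.
Lemma midealN x : M x -> M (- x).
Proof. by move=> Mx; rewrite -mulN1r; exact: midealMl. Qed.
Lemma midealB x y : M x -> M y -> M (x - y).
Proof. by move=> Mx My; apply: midealD => //; exact: midealN. Qed.
Lemma midealZ (z : R[i]) x : M x -> M (z *: x).
Proof. by move=> Mx; rewrite -[x]mul1r scalerAl; exact: midealMl. Qed.
Lemma mideal_sum (I : Type) (s : seq I) (F : I -> A) : (forall i, M (F i)) -> M (\sum_(i <- s) F i).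
Proof. by move=> MF; elim/big_ind: _ => //; [exact: mideal0|exact: midealD]. Qed.
Lemma mideal_not_invertible x : invertible x -> ~ M x.
Proof. by move=> [y [xy _]] Mx; apply: mideal1; rewrite -xy; exact: midealMr. Qed.

(** The closure of [M] is still an ideal, and proper because elements near 1 are invertible;
    maximality applies. *)
Lemma mideal_closed x : (forall e, 0 < e -> exists2 m, M m & nrm (x - m) < e) -> M x.
Proof.
pose N : set A := fun x => forall e, 0 < e -> exists2 m, M m & nrm (x - m) < e.
move: x; suff PN : proper_ideal N.
  apply: (maxM PN) => x Mx e e0; exists x => //.
  by rewrite subrr (nrm0 hA).
split.
- by move=> e e0; exists 0; [exact: mideal0|rewrite subrr (nrm0 hA)].
- move=> x y Nx Ny e e0; have e2 : 0 < e / 2 by rewrite divr_gt0.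
  have [m Mm xm] := Nx _ e2; have [m' Mm' ym'] := Ny _ e2.
  exists (m + m'); first exact: midealD.
  have -> : x + y - (m + m') = (x - m) + (y - m') by ncring.
  by apply: le_lt_trans (nrmD hA _ _) _; move: xm ym'; lra.
- move=> a x c Nx e e0; have K0 : 0 <= nrm a * nrm c by exact: mulr_ge0.
  have [|m Mm xm] := Nx (e / (nrm a * nrm c + 1)); first by apply: divr_gt0 => //; lra.
  exists (a * m * c); first exact: midealM.
  have -> : a * x * c - a * m * c = a * (x - m) * c by ncring.
  apply: le_lt_trans (nrmM hA _ _) _.
  apply: le_lt_trans (ler_wpM2r (nrm_nonneg c) (nrmM hA _ _)) _.
  rewrite ltr_pdivlMr in xm; last by lra.
  by rewrite mulrAC; have := nrm_nonneg (x - m); move: xm K0; nra.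
- move=> /(_ 1 ltr01)[m Mm m1].
  exact: mideal_not_invertible (near1_invertible hA m1) Mm.
Qed.

(** A spectral projection [E] for the large part of [y star y] is conjugate to an idempotent [e'] in
    [yA]. Since [y p = 0], the idempotent [x = e' p] satisfies [y = y (1 - x)], hence is halvable.
    So [M] contains [E] and [E y], while [(1 - E) y] is small. *)
Lemma mideal_corner p a : sa p -> idem p -> M (p * a * (1 - p)).
Proof.
move=> sp pp; set y := p * a * (1 - p).
have py : p * y = y by rewrite /y !mulrA pp.
have yp : y * p = 0 by rewrite /y -mulrA mulrBl mul1r pp subrr mulr0.
pose c := y * star y; have sc : sa c by rewrite /self_adjoint (star_mul hA) (star_invol hA).
have pc : p * c = c by rewrite /c mulrA py.
(* The square of the norm of [(1 - E) y] will be at most [de + de / 2], below [e ^+ 2]. *)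
apply: mideal_closed => e e0; pose de := e ^+ 2 / 2.
have de0 : 0 < de by rewrite divr_gt0 ?exprn_gt0.
have [|n [q [l [hq cl]]]] := diag_approx hA rr0 (e := de / 2) sc; first by rewrite divr_gt0.
set d := diag q l in cl; pose big i := de <= `|l i|.
pose E := diag q (fun i => if big i then 1 else 0).
pose f := diag q (fun i => if big i then (l i)^-1 else 0).
have bign0 i : big i -> l i != 0.
  by rewrite /big -normr_gt0; exact: lt_le_trans.
have EE : E * E = E.
  by rewrite (diagM hq); apply: eq_bigr => i _; case: ifP; rewrite ?mulr1 ?mulr0.
have fE : f * E = f.
  by rewrite (diagM hq); apply: eq_bigr => i _; case: ifP; rewrite ?mulr1 ?mulr0.
have df : d * f = E.
  rewrite (diagM hq); apply: eq_bigr => i _; case: ifP => [/bign0 li|_].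
    by rewrite mulfV.
  by rewrite mulr0.
have nf : nrm f <= de^-1.
  apply: (diag_norm hA hq); first by rewrite invr_ge0 ltW.
  move=> i; case: ifP => [bi|_]; last by rewrite normr0 invr_ge0 ltW.
  by rewrite normfV lef_pV2 // posrE // (lt_le_trans de0 bi).
have sF : 1 - E = diag q (fun i => if big i then 0 else 1).
  rewrite -(rsc1 A) -(diag_const hq) (diagB q); apply: eq_bigr => i _.
  by case: ifP; rewrite ?subrr ?subr0.
have nF : nrm (1 - E) <= 1.
  by rewrite sF; apply: (diag_norm hA hq) => // i; case: ifP; rewrite ?normr0 ?normr1.
have sa_F : sa (1 - E) by rewrite sF; exact: (sa_diag hA hq).
pose w := c * f + (1 - E).
have [g [wg gw]] : invertible w.
  apply: (near1_invertible hA).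
  have -> : 1 - w = - ((c - d) * f).
    by transitivity (E - c * f); [rewrite /w; ncring|rewrite -df; ncring].
  rewrite (nrmN hA); apply: le_lt_trans (nrmM hA _ _) _.
  apply: le_lt_trans (ler_wpM2l (nrm_nonneg _) nf) _.
  by rewrite ltr_pdivrMr // mul1r; move: cl de0; lra.
have wE : w * E = c * f.
  by rewrite /w mulrDl -mulrA fE mulrBl mul1r EE subrr addr0.
pose e' := w * E * g.
have e'e' : e' * e' = e'.
  transitivity (w * E * (g * w) * E * g); first by rewrite /e'; ncring.
  by rewrite gw mulr1 -(mulrA w) EE.
have pe' : p * e' = e' by rewrite /e' wE -(mulrA c f g) (mulrA p c) pc.
pose x := e' * p.
have px : p * x = x by rewrite /x mulrA pe'.
have xe' : x * e' = e' by rewrite /x -mulrA pe' e'e'.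
have xx : x * x = x by rewrite {2}/x mulrA xe'.
have yx : y * x = 0 by rewrite -px mulrA yp mul0r.
have Mx : M x.
  apply: IM; apply: ideal_mem; split=> //; exists y, (star y * f * g * p).
  by rewrite mulrBr mulr1 yx subr0 {1}/x /e' wE /c !mulrA.
have ME : M E.
  have -> : E = g * e' * w.
    transitivity ((g * w) * E * (g * w)); last by rewrite /e'; ncring.
    by rewrite gw mul1r mulr1.
  by apply: midealM; rewrite -xe'; exact: midealMr.
exists (E * y); first exact: midealMr.
have -> : y - E * y = (1 - E) * y by rewrite mulrBl mul1r.
have : nrm ((1 - E) * y) ^+ 2 <= de + de / 2.
  rewrite -(nrm_mul_star hA) (star_mul hA) sa_F.
  have -> : (1 - E) * y * (star y * (1 - E)) =
      (1 - E) * d * (1 - E) + (1 - E) * (c - d) * (1 - E) by rewrite /c; ncring.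
  apply: le_trans (nrmD hA _ _) _; apply: lerD.
    rewrite sF !(diagM hq); apply: (diag_norm hA hq); first exact: ltW.
    move=> i; case: ifP => bi; rewrite ?mul0r ?normr0 ?mulr1 ?mul1r; first exact: ltW.
    by rewrite ltW // ltNge; apply/negPf.
  apply: le_trans (nrmM hA _ _) _; have := nrmM hA (1 - E) (c - d).
  have := nrm_nonneg (1 - E); have := nrm_nonneg (c - d).
  have := nrm_nonneg ((1 - E) * (c - d)); move: nF cl; nra.
have := nrm_nonneg ((1 - E) * y); rewrite /de.
move: (nrm _) => v v0 vv; rewrite ltNge; apply/negP => ev.
have : e ^+ 2 <= v ^+ 2 by rewrite lerXn2r ?nnegrE // ltW.
have : 0 < e ^+ 2 by exact: exprn_gt0.
move: vv; lra.
Qed.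

(** The [z] with [z A (1 - p)] inside [M] form an ideal that contains [M] and, by [mideal_corner],
    [p]. Either it contains 1, or maximality puts it inside [M]. *)
Lemma mideal_prime p : sa p -> idem p -> M p \/ M (1 - p).
Proof.
move=> sp pp; pose N : set A := fun z => forall a, M (z * a * (1 - p)).
have [N1|N1] := EM (N 1); first by right; rewrite -[1 - p]mul1r -{1}[1]mulr1; exact: N1.
left; apply: (maxM (N := N)) => [||a]; last exact: mideal_corner.
- split=> //.
  + by move=> a; rewrite !mul0r; exact: mideal0.
  + by move=> x y Nx Ny a; rewrite !mulrDl; exact: midealD.
  + move=> b x c Nx a; rewrite -!mulrA; apply: midealMl.
    by rewrite !mulrA -(mulrA x); exact: Nx.
- by move=> x Mx a; rewrite -mulrA; exact: midealMr.
Qed.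

(** Some [q i] is outside [M]; then [M] contains [1 - q i] and every other projection of the
    family. *)
Lemma mideal_diag n (q : 'I_n -> A) l : proj_family star q -> exists t, M (diag q l - rsc t).
Proof.
move=> hq; have [sq oq q1] := hq.
have [i Mi] : exists i, ~ M (q i).
  by apply: contrapT => /forallNP H; apply: mideal1; rewrite -q1; apply: mideal_sum => i; apply: contrapT.
have [//|M1i] : M (q i) \/ M (1 - q i) by apply: mideal_prime => //; rewrite /idem oq eqxx.
exists (l i); rewrite -(diag_const hq) (diagB q); apply: mideal_sum => j.
have [->|ji] := eqVneq j i; first by rewrite subrr rsc0 mul0r; exact: mideal0.
apply: midealMl; have -> : q j = q j * (1 - q i) by rewrite mulrBr mulr1 oq (negbTE ji) subr0.
exact: midealMl.
Qed.

(** Otherwise [(t - t') - (d - d')] would be an invertible element of [M]. *)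
Lemma mideal_scalar_lip d d' t t' : M (d - rsc t) -> M (d' - rsc t') -> t - t' <= nrm (d - d').
Proof.
move=> Md Md'; rewrite leNgt; apply/negP => lt.
apply: (@mideal_not_invertible (rsc (t - t') - (d - d'))).
  apply: (near_rsc_invertible hA (r := t - t')); rewrite opprB addrC subrK //.
have -> : rsc (t - t') - (d - d') = (d' - rsc t') - (d - rsc t) by rewrite rscB; ncring.
exact: midealB.
Qed.

(** The scalar is the supremum of [t - nrm (a - d)] over all [d] that are scalars [t] modulo [M];
    the Lipschitz bound places it within [nrm (a - d)] of each such [t]. *)
Lemma mideal_scalar_sa a : sa a -> exists t, M (a - rsc t).
Proof.
move=> sa_a; pose S := [set s | exists d t, M (d - rsc t) /\ s = t - nrm (a - d)]%classic.
have approx e : 0 < e -> exists d t, M (d - rsc t) /\ nrm (a - d) < e.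
  move=> e0; have [n [q [l [hq aq]]]] := diag_approx hA rr0 sa_a e0.
  by have [t Mt] := mideal_diag l hq; exists (diag q l), t.
have S0 : (S !=set0)%classic.
  have [d [t [Mt _]]] := approx 1 ltr01; by exists (t - nrm (a - d)), d, t.
have Sub d t : M (d - rsc t) -> ubound S (t + nrm (a - d)).
  move=> Mt _ [d' [t' [Mt' ->]]]; have := mideal_scalar_lip Mt' Mt.
  have := nrmBt hA d' a d; rewrite [nrm (d' - a)](nrmBC hA); lra.
have hS : has_sup S.
  split=> //; have [d [t [Mt _]]] := approx 1 ltr01; exists (t + nrm (a - d)); exact: Sub.
exists (sup S); apply: mideal_closed => e e0; have [|d [t [Mt ad]]] := approx (e / 2).
  by rewrite divr_gt0.
exists (d - rsc t) => //.
have -> : a - rsc (sup S) - (d - rsc t) = (a - d) + rsc (t - sup S) by rewrite rscB; ncring.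
apply: le_lt_trans (nrmD hA _ _) _; rewrite (nrm_rsc hA).
have h1 : sup S <= t + nrm (a - d) by apply: ge_sup => //; exact: Sub.
have h2 : t - nrm (a - d) <= sup S by apply: (sup_upper_bound hS); exists d, t.
have : `|t - sup S| <= nrm (a - d) by rewrite ler_norml; apply/andP; split; lra.
by move: ad; lra.
Qed.

Lemma mideal_scalar a : exists z : R[i], M (a - z%:A).
Proof.
pose u := (2^-1 : R[i]) *: (a + star a); pose v := (2^-1 * 'i%C : R[i]) *: (star a - a).
have c2 : conjc (2^-1 : R[i]) = 2^-1 by rewrite conjc_inv conjc_nat.
have [s Ms] : exists s, M (u - rsc s).
  by apply: mideal_scalar_sa; rewrite /self_adjoint (star_scale hA) (star_add hA) (star_invol hA) c2 addrC.
have [t Mt] : exists t, M (v - rsc t).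
  apply: mideal_scalar_sa; rewrite /self_adjoint (star_scale hA) (starB hA) (star_invol hA).
  have -> : conjc (2^-1 * 'i%C) = 2^-1 * conjc 'i%C :> R[i] by rewrite -[in RHS]c2 -rmorphM.
  rewrite -opprB scalerN -scaleNr -mulrN; congr ((_ * _) *: _).
  by apply/eqP; rewrite eq_complex /= oppr0 opprK !eqxx.
have aE : a = u + 'i%C *: v.
  rewrite /u /v scalerA mulrCA -expr2 sqr_i mulrN1 scaleNr -scalerN opprB -scalerDr.
  have -> : a + star a + (a - star a) = (2 : R[i]) *: a.
    by rewrite scaler_nat mulr2n; ncring.
  by rewrite scalerA mulVf ?scale1r // pnatr_eq0.
exists ((s%:C)%C + 'i%C * (t%:C)%C).
have -> : a - ((s%:C)%C + 'i%C * (t%:C)%C)%:A = (u - rsc s) + 'i%C *: (v - rsc t).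
  by rewrite {1}aE scalerDl -scalerA scalerBr /real_scalar; ncring.
by apply: midealD => //; exact: midealZ.
Qed.

Lemma mideal_scalar_uniq a (z z' : R[i]) : M (a - z%:A) -> M (a - z'%:A) -> z = z'.
Proof.
move=> Mz Mz'; apply/eqP; rewrite -subr_eq0; apply/negPn/negP => zz'.
apply: mideal1; rewrite -(scale1r 1) -(mulVf zz') -scalerA; apply: midealZ.
have -> : (z - z')%:A = (a - z'%:A) - (a - z%:A) by rewrite scalerBl; ncring.
exact: midealB.
Qed.

Lemma character_of_maximal : exists f : A -> R[i], is_character f.
Proof.
have [f fP] := choice mideal_scalar; exists f; split.
- move=> x y; apply: (mideal_scalar_uniq (fP _)).
  have -> : x + y - (f x + f y)%:A = (x - (f x)%:A) + (y - (f y)%:A) by rewrite scalerDl; ncring.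
  exact: midealD.
- move=> z x; apply: (mideal_scalar_uniq (fP _)).
  by rewrite -scalerA -scalerBr; exact: midealZ.
- move=> x y; apply: (mideal_scalar_uniq (fP _)).
  have -> : x * y - (f x * f y)%:A = (x - (f x)%:A) * y + (f x)%:A * (y - (f y)%:A).
    have -> : (f x * f y)%:A = (f x)%:A * (f y)%:A :> A by rewrite -scalerAl mul1r scalerA.
    by ncring.
  by apply: midealD; [exact: midealMr|exact: midealMl].
- exists 1; apply/eqP => f1; apply: mideal1; have := fP 1.
  by rewrite f1 scale0r subr0.
Qed.

End Character.

(** * Conclusion for algebras without characters *)

Lemma no_character_ideal (R : realType) (A : algType R[i]) (star : A -> A) (nrm : A -> R) :
  is_unital_cstar star nrm -> real_rank_zero star nrm ->
  (forall f : A -> R[i], ~ is_character f) -> ideal (@halvable A) 1.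
Proof.
move=> hA rr0 nochar; apply: contrapT => /maximal_ideal[M [PM IM maxM]].
by have [f] := character_of_maximal hA rr0 PM IM maxM; exact: nochar.
Qed.

Theorem theorem6p3 (R : realType) (A : algType R[i]) (star : A -> A)
  (nrm : A -> R) :
  is_unital_cstar star nrm ->
  real_rank_zero star nrm ->
  (forall f : A -> R[i], ~ is_character f) ->
  (* xi(A) <= 3 : every element is a sum of 3 products of two commutators *)
  (forall x : A, exists b c d e : 'I_3 -> A,
      x = \sum_(k < 3) commr (b k) (c k) * commr (d k) (e k)) /\
  (* A = [A,A]_1 + [A,A]_1 . [A,A]_1 *)
  (forall x : A, exists b c d e f g : A,
      x = commr b c + commr d e * commr f g).
Proof.
move=> hA rr0 nochar; have ex := cstar_exchange hA rr0.
have [P [PP P1 Q1]] := exchange_full_halving ex (no_character_ideal hA rr0 nochar).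
split=> x; have [U [V [c [[[u1 [u2 ->]] [v1 [v2 ->]] [c1 [c2 cE]]] [->]]]]] :=
  full_halving_commr ex PP P1 Q1 x; last first.
  by move=> _; exists c1, c2, u1, u2, v1, v2; rewrite addrC -cE.
move=> [Y [Z [d [e [[[y1 [y2 ->]] [z1 [z2 ->]] [d1 [d2 ->]] [e1 [e2 ->]]] ->]]]]].
(* The three products are [U V], [Y d] and [Z e]. *)
exists (fun k => [:: u1; y1; z1]`_k), (fun k => [:: u2; y2; z2]`_k),
  (fun k => [:: v1; d1; e1]`_k), (fun k => [:: v2; d2; e2]`_k).
by rewrite !big_ord_recl big_ord0 /= addr0.
Qed.
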